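(* There is a constant $c_{\mathbb C}>0$, depending only on the conventions fixed for $dd^c$, $dV$ and the identification of $(n-1,n-1)$-forms with Hermitian matrices described in the context, such that the following holds. Let $\Omega\subset\mathbb C^n$ be a bounded domain, $x\in\Omega$, $\mu\in J_{x,\mathrm{PSH}}^{\partial}$, and $f\in C(\overline\Omega)$, $f\ge 0$. Let $T$ be a positive current of bidimension $(1,1)$, supported in $\overline\Omega$, satisfying $$\int_{\partial\Omega}\phi\,d\mu-\phi(x)=\langle T,dd^c\phi\rangle$$ for all smooth functions $\phi$ on a neighbourhood of $\overline\Omega$, and write its absolutely continuous part as $T_{ac}=\Theta\,dV$. Then for every smooth plurisubharmonic $u$ (smooth on a neighbourhood of $\overline\Omega$, plurisubharmonic in $\Omega$) with $(dd^cu)^n\ge f\,dV$ in $\Omega$, $$\int_{\partial\Omega}u\,d\mu-u(x)\ \ge\ c_{\mathbb C}\int_\Omega f^{1/n}\det(\Theta)^{1/n}\,dV .$$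
   Context: $\mathrm{PSH}(\Omega)$ is the set of plurisubharmonic functions on $\Omega$; $dV$ is Lebesgue measure; $dd^c$ is a fixed positive multiple of $i\partial\bar\partial$. $J_{x,\mathrm{PSH}}^{\partial}$ is the set of Borel probability measures $\mu$ on $\partial\Omega$ with $v(x)\le\int_{\partial\Omega}v\,d\mu$ for all $v\in\mathrm{PSH}(\Omega)\cap C(\overline\Omega)$. A positive current of bidimension $(1,1)$ is a current of bidegree $(n-1,n-1)$ with measure coefficients. Fix once and for all the contracted basis identifying (strongly) positive $(n-1,n-1)$-forms with positive semidefinite Hermitian matrices: the form $\tau$ corresponds to the Hermitian matrix $\Theta=(\Theta_{kj})$ determined by $i\,dz_j\wedge d\bar z_k\wedge\tau=\Theta_{kj}\,dV$, so that for smooth $u$ with complex Hessian $H=(\partial^2u/\partial z_j\partial\bar z_k)$ the product $dd^cu\wedge\tau$ is a fixed positive constant times $\operatorname{tr}(H\Theta)\,dV$. Under this identification the absolutely continuous part (with respect to Lebesgue measure) of $T$ is written $T_{ac}=\Theta\,dV$ with $\Theta$ a positive semidefinite Hermitian matrix-valued function. *)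

(* Defs.v *)
From HB Require Import structures.
From mathcomp Require Import all_boot all_order all_fingroup all_algebra.
From mathcomp Require Import complex.
From mathcomp Require Import all_classical all_reals all_analysis.

Set Implicit Arguments.
Unset Strict Implicit.
Unset Printing Implicit Defensive.

Import Order.TTheory GRing.Theory Num.Theory.
Import numFieldNormedType.Exports.

Local Open Scope classical_set_scope.
Local Open Scope complex_scope.
Local Open Scope ring_scope.

HB.instance Definition _ (R : realType) (m : nat) :=
  @isMeasurable.Build (sigma_display (@open 'rV[R]_m)) 'rV[R]_m
    <<s @open 'rV[R]_m >> (@sigma_algebra0 _ setT _) (@sigma_algebraC _ _)
    (@sigma_algebra_bigcup _ setT _).

Section borel_rV.
Context (R : realType).

Lemma measurable_coord_rV m (i : 'I_m) :
  measurable_fun [set: 'rV[R]_m] (fun v : 'rV[R]_m => v 0 i).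
Proof.
apply: (@measurability _ _ _ (measurableTypeR R) _ _ _ (measurable_realfun.RGenOInfty.measurableE R)) => _ [_ [x ->] <-].
rewrite setTI; apply: sub_sigma_algebra.
apply: (@open_comp _ _ (fun v : 'rV[R]_m => v 0 i)).
  by move=> v _; exact: coord_continuous.
exact: interval_open.
Qed.

Lemma measurable_fun_rV d (T : measurableType d) m (f : T -> 'rV[R]_m) :
  (forall i, measurable_fun setT (fun t => f t 0 i)) -> measurable_fun setT f.
Proof.
move=> mf; apply: (@measurability _ _ _ _ _ _ (@open 'rV[R]_m)) => // _ [U oU <-].
rewrite setTI.
pose I (q : {ffun 'I_m -> rat * rat}) i : set R :=
  `]ratr (q i).1, ratr (q i).2[%classic.
pose B q := [set v : 'rV[R]_m | forall i, I q i (v 0 i)].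
have -> : f @^-1` U = \bigcup_q
    (if `[< B q `<=` U >] then \bigcap_i [set t | I q i (f t 0 i)] else set0).
  apply/seteqP; split => [t Uft|t [q _]]; last first.
    by case: asboolP => // BU ft; apply: BU => i; exact: ft.
  have [e e0 eU] : exists2 e : R, 0 < e & ball (f t) e `<=` U.
    by have /nbhs_ballP[e /= e0 eU] := open_nbhs_nbhs (conj oU Uft); exists e.
  have qP i : exists q : rat * rat, [/\ f t 0 i - e < ratr q.1,
      ratr q.1 < f t 0 i, f t 0 i < ratr q.2 & ratr q.2 < f t 0 i + e].
    have /rat_in_itvoo[q1] : f t 0 i - e < f t 0 i by rewrite ltrBlDr ltrDl.
    rewrite in_itv/= => /andP[? ?].
    have /rat_in_itvoo[q2] : f t 0 i < f t 0 i + e by rewrite ltrDl.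
    by rewrite in_itv/= => /andP[? ?]; exists (q1, q2).
  pose q := [ffun i => sval (cid (qP i))]; exists q => //.
  case: asboolP => [_ i _ /=|[]]; last first.
    move=> v Iv; apply: eU; split => // i j; rewrite (ord1 i).
    have := Iv j; rewrite /I /q ffunE /=; case: cid => -[a b] /= [? ? ? ?].
    rewrite in_itv/= => /andP[? ?]; rewrite /ball/= ltr_distlC.
    by apply/andP; split; [apply: lt_trans; eassumption|apply: lt_trans; eassumption].
  by rewrite /I /q ffunE /=; case: cid => -[a b] /= [? ? ? ?]; rewrite in_itv/=; apply/andP.
apply: countable_bigcupT_measurable => [|q]; first exact: countableP.
case: ifP => // _.
apply: fin_bigcap_measurable => [|i _]; first exact: finite_finset.
by rewrite -[X in measurable X]setTI; apply: mf => //; exact: measurable_itv.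
Qed.

Definition cons_rV m (p : R * 'rV[R]_m) : 'rV[R]_m.+1 :=
  row_mx (const_mx p.1 : 'rV_1) p.2.

Definition uncons_rV m (v : 'rV[R]_m.+1) : R * 'rV[R]_m :=
  (v 0 0, \row_j v 0 (lift 0 j)).

Lemma cons_rVK m : cancel (@cons_rV m) (@uncons_rV m).
Proof.
case=> a v; rewrite /uncons_rV /cons_rV; congr pair.
  by rewrite mxE; case: splitP => [j _|j //]; rewrite mxE.
apply/rowP => j; rewrite !mxE; case: splitP => [[[]]//|k /= [jk]].
by congr (v _ _); apply: val_inj; case: jk.
Qed.

Lemma measurable_cons_rV m : measurable_fun setT (@cons_rV m).
Proof.
apply: measurable_fun_rV => i.
have [j ij|j ij] := split_ordP (i : 'I_(1 + m)).
  rewrite (_ : (fun t => _) = fst); first exact: measurable_fst.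
  by apply/funext => t; rewrite ij [LHS]row_mxEl mxE.
rewrite (_ : (fun t => _) = (fun v : 'rV_m => v 0 j) \o snd).
  exact: (measurableT_comp (measurable_coord_rV j) measurable_snd).
by apply/funext => t; rewrite ij [LHS]row_mxEr.
Qed.

Lemma measurable_uncons_rV m : measurable_fun setT (@uncons_rV m).
Proof.
apply/measurable_fun_pairP; split; first exact: measurable_coord_rV.
apply: measurable_fun_rV => i.
rewrite (_ : (fun t => _) = fun v : 'rV_m.+1 => v 0 (lift 0 i)).
  exact: measurable_coord_rV.
by apply/funext => t /=; rewrite mxE.
Qed.

End borel_rV.

Section lebesgue_rV.
Context (R : realType) (m : nat).
Variable mu : {sigma_finite_measure set 'rV[R]_m -> \bar R}.
Local Open Scope ereal_scope.

Definition lebesgue_cons_rV : set 'rV[R]_m.+1 -> \bar R :=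
  pushforward (@lebesgue_measure R \x mu) (@cons_rV R m).

Let lebesgue_cons_rV0 : lebesgue_cons_rV set0 = 0.
Proof. by apply: measure0; exact: measurable_cons_rV. Qed.

Let lebesgue_cons_rV_ge0 A : 0 <= lebesgue_cons_rV A.
Proof. by apply: measure_ge0; exact: measurable_cons_rV. Qed.

Let lebesgue_cons_rV_sigma_additive : semi_sigma_additive lebesgue_cons_rV.
Proof.
by apply: measure_semi_sigma_additive; exact: measurable_cons_rV.
Qed.

HB.instance Definition _ := isMeasure.Build _ _ _ lebesgue_cons_rV
  lebesgue_cons_rV0 lebesgue_cons_rV_ge0 lebesgue_cons_rV_sigma_additive.

Let lebesgue_cons_rV_sigma_finite : sigma_finite setT lebesgue_cons_rV.
Proof.
have /sigma_finiteP[F [TF ndF Foo]] := sigma_finiteT (@lebesgue_measure R).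
have /sigma_finiteP[G [TG ndG Goo]] := sigma_finiteT mu.
exists (fun k => @uncons_rV R m @^-1` (F k `*` G k)).
  rewrite -preimage_bigcup; apply/seteqP; split => // v _ /=.
  have [i _ Fi] : (\bigcup_k F k) (uncons_rV v).1 by rewrite -TF.
  have [j _ Gj] : (\bigcup_k G k) (uncons_rV v).2 by rewrite -TG.
  exists (maxn i j) => //; split.
  - by move: Fi; exact/subsetPset/ndF/leq_maxl.
  - by move: Gj; exact/subsetPset/ndG/leq_maxr.
move=> k; have [mF Fk] := Foo k; have [mG Gk] := Goo k; split.
  rewrite -[X in measurable X]setTI; apply: measurable_uncons_rV => //.
  exact: measurableX.
rewrite /lebesgue_cons_rV /pushforward -comp_preimage.
rewrite (_ : _ \o _ = id); last by apply/funext => p /=; exact: cons_rVK.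
by rewrite preimage_id product_measure1E// lte_mul_pinfty// ge0_fin_numE.
Qed.

HB.instance Definition _ := Measure_isSigmaFinite.Build _ _ _ lebesgue_cons_rV
  lebesgue_cons_rV_sigma_finite.

End lebesgue_rV.

Fixpoint lebesgue_rV (R : realType) (m : nat) :
    {sigma_finite_measure set 'rV[R]_m -> \bar R} :=
  if m is m'.+1 then lebesgue_cons_rV (lebesgue_rV R m') else \d_ (0 : 'rV[R]_0).

Section several_complex_variables.
Context (R : realType) (n : nat).

(* C^n is 'rV[R]_(n + n), with z_j = z_(lshift j) + i z_(rshift j). *)
Local Notation Cn := 'rV[R]_(n + n).
Implicit Types (Omega U K : set Cn) (z a w v : Cn).

Definition cplx_of_rV z : 'rV[R[i]]_n :=
  \row_j (z 0 (lshift n j) +i* z 0 (rshift n j)).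

Definition rV_of_cplx (w : 'rV[R[i]]_n) : Cn :=
  row_mx (map_mx (@complex.Re R) w) (map_mx (@complex.Im R) w).

Definition complex_scale (lambda : R[i]) w : Cn :=
  rV_of_cplx (lambda *: cplx_of_rV w).

Definition boundary Omega := closure Omega `\` interior Omega.

(* Iterated directional derivatives; on an open set they only depend on the
   values of phi in that set. *)
Definition iter_derive (s : seq Cn) (phi : Cn -> R) : Cn -> R :=
  foldr (fun v g => 'D_v g) phi s.

Definition smooth_on U (phi : Cn -> R) :=
  forall (s : seq Cn) z, U z ->
    {for z, continuous (iter_derive s phi)} /\
    forall v, derivable (iter_derive s phi) z v.

Definition smooth_near K (phi : Cn -> R) :=
  exists U, [/\ open U, K `<=` U & smooth_on U phi].

(* Upper semicontinuous functions with values in [-oo, +oo[ satisfying the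
   sub-mean value inequality on every closed disc of a complex line that lies
   in Omega. The constant function -oo is not excluded. *)
Definition psh Omega (phi : Cn -> \bar R) :=
  (forall a, Omega a -> (phi a < +oo)%E /\
     forall t : R, (phi a < t%:E)%E -> \forall z \near a, (phi z < t%:E)%E) /\
  (forall a w,
     (forall lambda : R[i], `|lambda| <= 1 -> Omega (a + complex_scale lambda w)) ->
     (phi a <= (2 * pi)^-1%:E *
       \int[@lebesgue_measure R]_(t in `[0%R, (2 * pi)%R])
          phi (a + complex_scale (cos t +i* sin t) w)%R)%E).

(* Probability measures on the boundary of Omega, as Borel measures on C^n. *)
Definition jensen_boundary Omega (x : Cn) (mu : probability Cn R) :=
  mu (boundary Omega) = 1%E /\
  forall v : Cn -> R, {within closure Omega, continuous v} ->
    psh Omega (EFin \o v) ->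
    ((v x)%:E <= \int[mu]_(z in boundary Omega) (v z)%:E)%E.

(* lshift n j is the direction x_j, rshift n j the direction y_j. *)
Definition real_basis (p : 'I_(n + n)) : Cn := delta_mx 0 p.

Definition cderive v (g : Cn -> R[i]) z : R[i] :=
  ('D_v (fun y => complex.Re (g y)) z) +i* ('D_v (fun y => complex.Im (g y)) z).

Definition wirtinger (j : 'I_n) (g : Cn -> R[i]) z : R[i] :=
  2^-1 * (cderive (real_basis (lshift n j)) g z
    - 'i%C * cderive (real_basis (rshift n j)) g z).

Definition wirtinger_bar (j : 'I_n) (g : Cn -> R[i]) z : R[i] :=
  2^-1 * (cderive (real_basis (lshift n j)) g z
    + 'i%C * cderive (real_basis (rshift n j)) g z).

Definition complex_hessian (u : Cn -> R) z : 'M[R[i]]_n :=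
  \matrix_(j, k) wirtinger j (wirtinger_bar k (fun y => (u y)%:C)) z.

(* A (1,1)-form i sum_jk a_jk dz_j /\ dzbar_k is given by its coefficients a;
   here those of dd^c u, for the normalisation dd^c = kappa i d dbar. *)
Definition ddc (kappa : R) (u : Cn -> R) z : 'M[R[i]]_n :=
  kappa%:C *: complex_hessian u z.

Definition form11_eval (a : 'M[R[i]]_n) v w : R[i] :=
  let dz j (y : Cn) := cplx_of_rV y 0 j in
  'i%C * \sum_j \sum_k a j k *
    (dz j v * (dz k w)^* - dz j w * (dz k v)^*).

(* The density with respect to Lebesgue measure of the n-th exterior power of a
   2-form omega, i.e. omega^n evaluated at (d/dx_1, d/dy_1, .., d/dx_n, d/dy_n):
   2^-n sum_sigma sgn(sigma) prod_m omega(e_sigma(2m-1), e_sigma(2m)).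
   Relabelling the basis and the positions in the same way does not change the
   signs, so that the m-th factor may use the positions lshift m, rshift m. *)
Definition form11_top (a : 'M[R[i]]_n) : R[i] :=
  (2 ^+ n)^-1 * \sum_(s : 'S_(n + n)) (-1) ^+ s *
    \prod_(m < n) form11_eval a (real_basis (s (lshift n m)))
                                (real_basis (s (rshift n m))).

Definition psdmx (A : 'M[R[i]]_n) :=
  A^T = map_mx Num.conj A /\
  forall xi : 'cV[R[i]]_n, 0 <= ((map_mx Num.conj xi)^T *m A *m xi) 0 0.

End several_complex_variables.

Section currents.
Context (R : realType) (n : nat).
Local Notation Cn := 'rV[R]_(n + n).

Record complex_measure := ComplexMeasure {
  re_measure : {charge set Cn -> \bar R};
  im_measure : {charge set Cn -> \bar R} }.

Definition cmeas (nu : complex_measure) (A : set Cn) : R[i] :=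
  fine (re_measure nu A) +i* fine (im_measure nu A).

Definition charge_integral (nu : {charge set Cn -> \bar R}) (K : set Cn)
    (g : Cn -> R) : R :=
  let: exist P exN := cid (Hahn_decomposition nu) in
  let: exist N nuPN := cid exN in
  \int[jordan_pos nuPN]_(z in K) g z - \int[jordan_neg nuPN]_(z in K) g z.

Definition cmeas_integral (nu : complex_measure) (K : set Cn)
    (g : Cn -> R[i]) : R[i] :=
  let Reg z := complex.Re (g z) in let Img z := complex.Im (g z) in
  (charge_integral (re_measure nu) K Reg - charge_integral (im_measure nu) K Img)
  +i* (charge_integral (re_measure nu) K Img
       + charge_integral (im_measure nu) K Reg).

(* A current of bidegree (n-1, n-1) with measure coefficients, through its
   coefficients in the contracted basis: T k j = i dz_j /\ dzbar_k /\ T.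
   Compactly supported coefficients have finite total variation. *)
Definition current := 'I_n -> 'I_n -> complex_measure.
Implicit Type T : current.

(* T /\ i alpha /\ alphabar >= 0 for every alpha = sum_j xi_j dz_j. *)
Definition positive_current T :=
  forall (xi : 'I_n -> R[i]) (A : set Cn), measurable A ->
    0 <= \sum_j \sum_k xi j * (xi k)^* * cmeas (T k j) A.

Definition supported_in (K : set Cn) T :=
  forall (A : set Cn), measurable A -> A `&` K = set0 ->
    forall k j, cmeas (T k j) A = 0.

(* <T, i sum_jk a_jk dz_j /\ dzbar_k> for T supported in K. *)
Definition current_pairing (K : set Cn) T (a : Cn -> 'M[R[i]]_n) : R[i] :=
  \sum_j \sum_k cmeas_integral (T k j) K (fun z => a z j k).

(* Lebesgue decomposition T = Theta dV + S with S singular. *)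
Definition ac_density T (Theta : Cn -> 'M[R[i]]_n) :=
  let dV := lebesgue_rV R (n + n) in
  [/\ forall k j, dV.-integrable setT (fun z => (complex.Re (Theta z k j))%:E),
      forall k j, dV.-integrable setT (fun z => (complex.Im (Theta z k j))%:E) &
      exists (S : current) (N : set Cn), [/\ measurable N, dV N = 0%E &
        forall k j (A : set Cn), measurable A ->
          cmeas (S k j) A = cmeas (S k j) (A `&` N) /\
          cmeas (T k j) A =
            (\int[dV]_(z in A) complex.Re (Theta z k j)) +i*
            (\int[dV]_(z in A) complex.Im (Theta z k j)) + cmeas (S k j) A]].

End currents.

(* Main.v *)
(** Testing the identity for T against u gives
    [\int u dmu - u x = <T, dd^c u> = \sum_jk \int a_jk dT_kj], where the coefficient
    matrix a of dd^c u is positive semidefinite on the closure of Omega: on Omega by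
    the sub-mean value property and a second order Taylor expansion on small
    circles, on the boundary by continuity. The singular part of T is positive, as
    the restriction of T to a Lebesgue-null set, so it only increases the pairing,
    which is therefore at least [\int tr (a Theta) dV]. Finally
    [(dd^c u)^n = n! 2^n det a dV], the AM-GM inequality for the eigenvalues of
    [a^(1/2) Theta a^(1/2)] gives [det a det Theta <= (tr (a Theta) / n)^n], and
    [n! <= n^n], whence [f^(1/n) (det Theta)^(1/n) <= 2 tr (a Theta)]: the constant
    1/2 works in every dimension and for every kappa. *)
Require Import Defs.
From mathcomp Require Import all_boot all_order all_fingroup all_algebra.
From mathcomp Require Import complex.
From mathcomp Require Import all_classical all_reals all_analysis.
From mathcomp Require Import measurable_realfun ring lra.

Set Implicit Arguments.
Unset Strict Implicit.
Unset Printing Implicit Defensive.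

Import Order.TTheory GRing.Theory Num.Theory.
Import numFieldNormedType.Exports.

Local Open Scope classical_set_scope.
Local Open Scope complex_scope.
Local Open Scope ring_scope.

(** * The top exterior power of a (1,1)-form *)

(** The same matrix a, the coefficients of dd^c u, enters both the pairing with T and the hypothesis
    on (dd^c u)^n, so kappa never has to be tracked; the 2 in the constant is that of i dz /\ dzbar
    = 2 dx /\ dy. Two obstacles shape the proof. Smoothness speaks of directional derivatives only,
    so linearity in the direction and the symmetry of second derivatives are derived from
    continuity; they make Dvv + Dww, for w = i v, equal to four times the Levi form at v. The
    coefficients of T are charges that are positive only jointly: what is known is that sum a_jk
    T_kj(A) >= 0 for a constant positive matrix a and a set A. *)

Section top_form.
Variable F : comNzRingType.

(** The signed sum already antisymmetrises, so each explicit antisymmetrisation only contributes a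
    factor 2. The resulting 2^n cancels the normalisation 2^-n in [form11_top]. *)
Lemma sum_perm_antisym n (B : 'I_(n + n) -> 'I_(n + n) -> F) :
  \sum_(s : 'S_(n + n)) (-1) ^+ s *
    \prod_(m < n) (B (s (lshift n m)) (s (rshift n m))
                   - B (s (rshift n m)) (s (lshift n m))) =
  2 ^+ n * \sum_(s : 'S_(n + n)) (-1) ^+ s *
    \prod_(m < n) B (s (lshift n m)) (s (rshift n m)).
Proof.
pose D (s : 'S_(n + n)) m : F := B (s (lshift n m)) (s (rshift n m)).
pose D' (s : 'S_(n + n)) m : F := B (s (rshift n m)) (s (lshift n m)).
(* Antisymmetrise only the first k factors; composing s with the transposition
   of the two positions of factor k doubles the sum at each step. *)
pose P k := \sum_(s : 'S_(n + n)) (-1) ^+ s *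
  \prod_(m < n) (if (m < k)%N then D s m - D' s m else D s m).
suff PE k : (k <= n)%N -> P k = 2 ^+ k * P 0%N.
  rewrite -[LHS](_ : P n = _); last first.
    by apply: eq_bigr => s _; congr *%R; apply: eq_bigr => m _; rewrite ltn_ord.
  by rewrite PE.
elim: k => [|k IH] kn; first by rewrite mul1r.
rewrite exprS -mulrA -IH 1?ltnW//.
pose m0 := Ordinal kn; pose t := tperm (lshift n m0) (rshift n m0).
pose Q s := \prod_(m < n | m != m0) (if (m < k)%N then D s m - D' s m else D s m).
have PkE : P k = \sum_(s : 'S_(n + n)) (-1) ^+ s * (D s m0 * Q s).
  by apply: eq_bigr => s _; rewrite (bigD1 m0)//= ltnn.
have PSkE : P k.+1 = \sum_(s : 'S_(n + n)) (-1) ^+ s * ((D s m0 - D' s m0) * Q s).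
  apply: eq_bigr => s _; rewrite (bigD1 m0)//= ltnSn; congr (_ * (_ * _)).
  apply: eq_bigr => m mm0; rewrite ltnS leq_eqVlt (_ : (m == k :> nat) = false)//.
  by apply: contraNF mm0 => /eqP mk; apply/eqP/val_inj.
rewrite PSkE mulr_natl mulr2n {1}PkE.
under eq_bigr do rewrite mulrBl mulrBr.
rewrite sumrB; congr (_ + _); rewrite PkE -sumrN.
rewrite (reindex_inj (mulgI t)) /=; apply: eq_bigr => s _.
have l_neq_r : lshift n m0 != rshift n m0 by rewrite eq_lrshift.
rewrite odd_permM odd_tperm l_neq_r signr_addb expr1 !mulN1r !mulNr opprK.
congr (_ * (_ * _)); first by rewrite /D' /D !permM tpermL tpermR.
apply: eq_bigr => m mm0; rewrite /D /D' !permM.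
by rewrite !tpermD ?(eq_lshift, eq_rshift, eq_lrshift, eq_rlshift)// eq_sym.
Qed.

(** Row i of the matrix is the basis vector of index K i: a permutation matrix when K is injective,
    two equal rows otherwise. *)
Lemma det_rowsub_sqr n (K : {ffun 'I_n -> 'I_n}) :
  (\det (rowsub K 1%:M : 'M[F]_n)) ^+ 2 = (injectiveb K)%:R.
Proof.
have [/injectiveP injK|/injectivePn[i [j ij Kij]]] := boolP (injectiveb K).
  rewrite (_ : rowsub K _ = perm_mx (perm injK)); last first.
    by apply/matrixP => i j; rewrite !mxE permE.
  by rewrite det_perm sqrr_sign.
rewrite (determinant_alternate ij) ?expr0n// => k.
by rewrite !mxE Kij.
Qed.

Lemma sum_det_rowsub_sqr n :
  \sum_(K : {ffun 'I_n -> 'I_n}) (\det (rowsub K 1%:M : 'M[F]_n)) ^+ 2 = n`!%:R.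
Proof.
under eq_bigr do rewrite det_rowsub_sqr.
rewrite -natr_sum; congr _%:R.
have := card_inj_ffuns 'I_n 'I_n; rewrite !card_ord ffactnn -sum1_card => <-.
rewrite [RHS]big_mkcond; apply: eq_bigr => K _; rewrite inE.
by case: ifP.
Qed.

(* Each choice K of the inner indices contributes the determinant of
   [col_mx (P A) (P B)] with P the 0-1 matrix [rowsub K 1%:M] of K, that is
   [\det P ^+ 2 * \det (col_mx A B)]. *)
Lemma sum_perm_prod_col n (A B : 'M[F]_(n, n + n)) :
  \sum_(s : 'S_(n + n)) (-1) ^+ s *
    \prod_(m < n) \sum_(k < n) A k (s (lshift n m)) * B k (s (rshift n m)) =
  n`!%:R * \det (col_mx A B).
Proof.
rewrite -sum_det_rowsub_sqr mulr_suml.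
under eq_bigr do rewrite bigA_distr_bigA mulr_sumr.
rewrite exchange_big; apply: eq_bigr => K _ /=.
(* The square is the determinant of the block diagonal matrix with two copies of P, one acting on A
   and one on B. *)
rewrite expr2.
rewrite -[X in X * \det (col_mx _ _)](det_ublock _ 0) -det_mulmx mul_block_col.
rewrite !mul0mx addr0 add0r !mul_rowsub_mx !mul1mx.
apply: eq_bigr => s _; congr *%R.
rewrite big_split_ord /= -big_split /=; apply: eq_bigr => m _.
by rewrite col_mxEu col_mxEd !mxE.
Qed.

End top_form.

Section form11_top_det.
Context (R : realType).
Local Notation C := R[i].

(** With alpha_k = i sum_j a_jk dz_j and beta_k = dzbar_k the form is sum_k alpha_k /\ beta_k, so
    its top power is n! times the determinant of these 2n covectors on the real basis. *)
Lemma form11_topE n (a : 'M[C]_n) :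
  form11_top a = n`!%:R * 2 ^+ n * \det a.
Proof.
pose z (j : 'I_n) (p : 'I_(n + n)) : C := cplx_of_rV (real_basis R p) 0 j.
pose A := \matrix_(k < n, p < n + n) ('i%C * \sum_j a j k * z j p).
pose B := \matrix_(k < n, p < n + n) (z k p)^*.
have evalE p q : form11_eval a (real_basis R p) (real_basis R q) =
    \sum_k A k p * B k q - \sum_k A k q * B k p.
  rewrite /form11_eval exchange_big /= mulr_sumr -sumrB; apply: eq_bigr => k _.
  rewrite ![A _ _]mxE ![B _ _]mxE -!mulrA -mulrBr; congr *%R.
  by rewrite !mulr_suml -sumrB; apply: eq_bigr => j _; rewrite /z mulrBr !mulrA.
rewrite /form11_top.
under eq_bigr do under eq_bigr do rewrite evalE.
rewrite (sum_perm_antisym (fun p q => \sum_k A k p * B k q)).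
rewrite mulrA mulVf ?expf_neq0 ?pnatr_eq0// mul1r sum_perm_prod_col -mulrA.
congr *%R.
have zl j m : z j (lshift n m) = (m == j)%:R.
  rewrite /z !mxE eqxx /= eq_lshift eq_rlshift eq_sym.
  by case: eqP.
have zr j m : z j (rshift n m) = 'i%C * (m == j)%:R.
  rewrite /z !mxE eqxx /= eq_lrshift eq_rshift eq_sym.
  by case: eqP; rewrite ?mulr0 ?mulr1.
(* The rows dz = (1, i) and dzbar = (1, -i) factor into a lower and an upper triangular block
   matrix, so every determinant is read off diagonal blocks; i^n from the first factor and (-2i)^n
   from the last multiply to 2^n. *)
have -> : col_mx A B = block_mx ('i%C *: a^T) 0 0 1%:M *m
    (block_mx 1%:M 0 1%:M 1%:M *m block_mx 1%:M ('i%C)%:M 0 (- 2 * 'i%C)%:M).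
  rewrite !mulmx_block !(mul1mx, mulmx1, mul0mx, mulmx0, addr0, add0r).
  rewrite block_mxEv; congr col_mx; apply/matrixP => k p;
    have [m ->|m ->] := split_ordP p; rewrite ?row_mxEl ?row_mxEr !mxE.
  - congr *%R; rewrite (bigD1 m)//= zl eqxx mulr1 big1 ?addr0// => j jm.
    by rewrite zl eq_sym (negPf jm) mulr0.
  - rewrite (bigD1 m)//= zr eqxx mulr1 big1 => [|j jm]; last first.
      by rewrite zr eq_sym (negPf jm) !mulr0.
    rewrite addr0 (bigD1 m)//= big1 => [|j jm]; last first.
      by rewrite !mxE (negPf jm) mulr0.
    by rewrite !mxE eqxx addr0 mulrA.
  - by rewrite zl rmorph_nat eq_sym.
  - rewrite zr eq_sym; case: eqP => _.
      rewrite !mulr1n mulr1; apply/eqP; rewrite eq_complex /=.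
      by apply/andP; split; apply/eqP; ring.
    by rewrite !mulr0n mulr0 rmorph0 addr0.
rewrite !det_mulmx !det_ublock !det_lblock !det1 !det_scalar detZ det_tr.
rewrite !(mul1r, mulr1) mulrAC -exprMn; congr (_ ^+ n * _).
rewrite mulrCA -expr2 sqr_i; ring.
Qed.

End form11_top_det.

(** * Positive semidefinite matrices *)

Section psdmx_theory.
Context (R : realType) (n : nat).
Local Notation C := R[i].
Local Notation adj A := (map_mx Num.conj A^T).
Implicit Types (A B S : 'M[C]_n).

(** Each eigenvalue is the value of the Hermitian form at a unit eigenvector, a column of the
    adjoint of P, hence nonnegative. *)
Lemma psdmx_spectral A : psdmx A -> exists (P : 'M[C]_n) (d : 'rV[C]_n),
  [/\ P *m adj P = 1%:M, A = adj P *m diag_mx d *m P & forall i, 0 <= d 0 i].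
Proof.
move=> [AT Age0].
have adjA : adj A = A.
  by rewrite AT -map_mx_comp; apply/map_mx_id => z /=; rewrite conjCK.
have nA : A \is normalmx by apply/normalmxP; rewrite adjA.
have Pu := spectral_unitarymx A.
set P := spectralmx A in Pu *.
have PP : P *m adj P = 1%:M by apply/unitarymxP.
move/orthomx_spectralP: nA; rewrite -/P invmx_unitary// => AE.
exists P, (spectral_diag A); split => // i.
have dE : P *m A *m adj P = diag_mx (spectral_diag A).
  by rewrite {1}AE !mulmxA PP mul1mx -mulmxA PP mulmx1.
have := Age0 (col i (adj P)).
rewrite (_ : (map_mx Num.conj (col i (adj P)))^T = row i P); last first.
  by apply/matrixP => k j; rewrite !mxE conjCK.
have -> : (row i P *m A *m col i (adj P)) 0 0 = (P *m A *m adj P) i i.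
  by rewrite -row_mul !mxE; apply: eq_bigr => j _; rewrite !mxE.
by rewrite dE mxE eqxx mulr1n.
Qed.

Lemma psdmx_det_le_tr A : psdmx A ->
  [/\ 0 <= \det A, 0 <= \tr A & \det A <= (\tr A / n%:R) ^+ n].
Proof.
move=> /psdmx_spectral[P [d [PP -> d_ge0]]].
have trE : \tr (adj P *m diag_mx d *m P) = \sum_i d 0 i.
  by rewrite -mulmxA mxtrace_mulC -mulmxA PP mulmx1 mxtrace_diag.
have detE : \det (adj P *m diag_mx d *m P) = \prod_i d 0 i.
  by rewrite !det_mulmx mulrAC -det_mulmx (mulmx1C PP) det1 mul1r det_diag.
rewrite trE detE; split.
- exact: prodr_ge0.
- exact: sumr_ge0.
- have := @leif_AGM _ _ [pred i : 'I_n | true] (d 0) (fun i _ => d_ge0 i).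
  by rewrite /= cardT size_enum_ord => -[].
Qed.

Lemma psdmx_sqrt A : psdmx A -> exists2 S, adj S = S & A = S *m S.
Proof.
move=> /psdmx_spectral[P [d [PP -> d_ge0]]].
pose e := map_mx sqrtC d; exists (adj P *m diag_mx e *m P).
  rewrite !trmx_mul !map_mxM tr_diag_mx map_diag_mx mulmxA.
  congr (_ *m _ *m _); last exact: trmxCK.
  congr diag_mx; apply/rowP => i; rewrite !mxE /= geC0_conj// sqrtC_ge0; exact: d_ge0.
rewrite !mulmxA -[_ *m P *m adj P]mulmxA PP mulmx1.
congr (_ *m _); rewrite -!mulmxA; congr (_ *m _).
apply/matrixP => i j; rewrite mul_diag_mx !mxE.
case: (eqVneq i j) => [->|_]; last by rewrite mulr0.
by rewrite !mulr1n -expr2 sqrtCK.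
Qed.

Lemma psdmx_congr S B : adj S = S -> psdmx B -> psdmx (S *m B *m S).
Proof.
move=> Sh [BT Bge0].
have ST : S^T = map_mx Num.conj S.
  by rewrite -[in RHS]Sh -map_mx_comp (map_mx_id _)// => z /=; rewrite conjCK.
split; first by rewrite !trmx_mul !map_mxM ST BT mulmxA.
move=> xi; have := Bge0 (S *m xi).
rewrite map_mxM trmx_mul /= (_ : (map_mx Num.conj S)^T = S) ?map_trmx//.
by rewrite !mulmxA.
Qed.

(** [A *m B] is not Hermitian in general; with S a Hermitian square root of A, [S *m B *m S] is
    positive and has the same trace and determinant. *)
Lemma psdmx_mul_det_le_tr A B : psdmx A -> psdmx B ->
  [/\ 0 <= \det A, 0 <= \det B, 0 <= \tr (A *m B) &
      \det A * \det B <= (\tr (A *m B) / n%:R) ^+ n].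
Proof.
move=> pA pB; have [dA _ _] := psdmx_det_le_tr pA.
have [dB _ _] := psdmx_det_le_tr pB.
have [S Sh AE] := psdmx_sqrt pA.
have [dS tS le] := psdmx_det_le_tr (psdmx_congr Sh pB).
have trE : \tr (S *m B *m S) = \tr (A *m B) by rewrite AE mxtrace_mulC mulmxA.
split=> //; first by rewrite -trE.
by rewrite -trE; apply: le_trans le; rewrite AE !det_mulmx mulrAC.
Qed.

End psdmx_theory.

Lemma psdmx_scale (R : realType) n (c : R) (A : 'M[R[i]]_n) :
  0 <= c -> psdmx A -> psdmx (c%:C *: A).
Proof.
move=> c0 [AT Age0]; split => [|xi].
  apply/matrixP => j k; move/matrixP: AT => /(_ j k); rewrite !mxE => ->.
  by rewrite rmorphM; congr (_ * _); apply/eqP; rewrite eq_complex /= oppr0 !eqxx.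
by rewrite -scalemxAr -scalemxAl mxE mulr_ge0// ler0c.
Qed.

Section trace_inequalities.
Context (R : realType) (n : nat).
Local Notation C := R[i].
Implicit Types (A B M : 'M[C]_n).

(** The spectral decomposition writes A as a nonnegative combination of rank-one matrices, on each
    of which the sum is the hypothesis at one vector. This passes from positivity against i alpha /\
    alphabar to positivity against every constant positive (1,1)-form. *)
Lemma psdmx_trace_ge0 A (M : 'I_n -> 'I_n -> C) : psdmx A ->
  (forall xi : 'I_n -> C, 0 <= \sum_j \sum_k xi j * (xi k)^* * M k j) ->
  0 <= \sum_j \sum_k A j k * M k j.
Proof.
move=> /psdmx_spectral[P [d [_ -> d_ge0]]] M_ge0.
have -> : \sum_j \sum_k (map_mx Num.conj P^T *m diag_mx d *m P) j k * M k j =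
    \sum_i d 0 i * \sum_j \sum_k (P i j)^* * ((P i k)^*)^* * M k j.
  under [RHS]eq_bigr do rewrite mulr_sumr.
  rewrite [RHS]exchange_big /=; apply: eq_bigr => j _.
  under [RHS]eq_bigr do rewrite mulr_sumr.
  rewrite [RHS]exchange_big /=; apply: eq_bigr => k _.
  rewrite mxE mulr_suml; apply: eq_bigr => i _.
  by rewrite mul_mx_diag !mxE conjCK; ring.
apply: sumr_ge0 => i _; apply: mulr_ge0; first exact: d_ge0.
exact: (M_ge0 (fun j => (P i j)^*)).
Qed.

Lemma form11_top_det_le_tr A B (f : R) : (0 < n)%N -> psdmx A -> psdmx B ->
  0 <= f -> f%:C <= form11_top A ->
  2^-1 * (f `^ n%:R^-1 * complex.Re (\det B) `^ n%:R^-1)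
    <= complex.Re (\tr (A *m B)).
Proof.
move=> n_gt0 pA pB f_ge0; rewrite form11_topE.
have [dA dB tAB] := psdmx_mul_det_le_tr pA pB.
have reE (z : C) : 0 <= z -> z = (complex.Re z)%:C.
  by move=> z_ge0; rewrite RRe_real ?ger0_real.
set t := complex.Re (\tr _); set b := complex.Re (\det B).
set a := complex.Re (\det A).
have n0 : n%:R != 0 :> R by rewrite pnatr_eq0 -lt0n.
rewrite (reE _ tAB) (reE _ dA) (reE _ dB) -/t -/b -/a => le1 fle.
have {}le1 : a * b <= (t / n%:R) ^+ n.
  by rewrite -lecR !(rmorphM, rmorphXn, fmorphV, rmorph_nat).
have {}fle : f <= n`!%:R * 2 ^+ n * a.
  by rewrite -lecR !(rmorphM, rmorphXn, rmorph_nat).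
have t_ge0 : 0 <= t by rewrite -lecR -reE.
have b_ge0 : 0 <= b by rewrite -lecR -reE.
have a_ge0 : 0 <= a by rewrite -lecR -reE.
(* n! <= n^n is what makes the constant 1/2 independent of n. *)
have le2 : f * b <= (2 * t) ^+ n.
  apply: le_trans (ler_wpM2r b_ge0 fle) _; rewrite -[leLHS]mulrA.
  rewrite (_ : 2 * t = n%:R * (2 * (t / n%:R))); last first.
    by rewrite mulrCA [_ * (t / _)]mulrC divfK.
  rewrite exprMn [(2 * _) ^+ n]exprMn [leRHS]mulrA; apply: ler_pM => //.
  - by rewrite mulr_ge0.
  - rewrite ler_pM2r ?exprn_gt0// -natrX ler_nat.
    by have := card_inj_ffuns 'I_n 'I_n; rewrite card_ord ffactnn => <-;
      apply: leq_trans (max_card _) _; rewrite card_ffun !card_ord.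
rewrite -powRM// ler_pdivrMl//.
have -> : 2 * t = ((2 * t) ^+ n) `^ n%:R^-1.
  by rewrite -powR_mulrn ?mulr_ge0// -powRrM mulfV// powRr1 ?mulr_ge0.
by apply: ge0_ler_powR; rewrite ?nnegrE ?mulr_ge0 ?exprn_ge0 ?mulr_ge0// invr_ge0.
Qed.

End trace_inequalities.

(** * Directional derivatives *)

Section directional_derivatives.
Context (R : realType) (V : normedModType R).
Implicit Types (U : set V) (g : V -> R) (a v w z : V).

Lemma is_derive_line g a v (t : R) : derivable g (a + t *: v) v ->
  is_derive t 1 (fun s : R => g (a + s *: v)) ('D_v g (a + t *: v)).
Proof.
rewrite /derivable => dg.
have E : (fun h : R => h^-1 *: ((fun s : R => g (a + s *: v)) (h *: 1 + t)
     - g (a + t *: v))) =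
  (fun h : R => h^-1 *: (g (h *: v + (a + t *: v)) - g (a + t *: v))).
  apply/funext => h; congr (_ *: (g _ - _)).
  by rewrite scalerDl addrCA [h *: 1]mulr1.
by split; [rewrite /derivable E | rewrite /derive E].
Qed.

Lemma derive_translate g c a v : 'D_v (fun z => g (z + c)) a = 'D_v g (a + c).
Proof.
rewrite /derive; set f1 := fun _ => _; set f2 := fun _ => _.
by rewrite (_ : f1 = f2)//; apply/funext => h; rewrite /f1 /f2 /= addrA.
Qed.

Lemma derivable_translate g c a v :
  derivable g (a + c) v -> derivable (fun z => g (z + c)) a v.
Proof.
rewrite /derivable; set f1 := fun _ => _; set f2 := fun _ => _.
by rewrite (_ : f1 = f2)//; apply/funext => h; rewrite /f1 /f2 /= addrA.
Qed.

Lemma MVT_line g a v (h : R) :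
  (forall s : R, `|s| <= `|h| -> derivable g (a + s *: v) v) ->
  exists2 s : R, `|s| <= `|h| & g (a + h *: v) - g a = h * 'D_v g (a + s *: v).
Proof.
move=> dg; pose p s := g (a + s *: v); pose dp s := 'D_v g (a + s *: v).
have isd (s : R) : `|s| <= `|h| -> is_derive s 1 p (dp s).
  by move=> sh; exact: (is_derive_line (dg _ sh)).
have ctn (x y : R) : (forall s, x <= s <= y -> `|s| <= `|h|) ->
    {within `[x, y], continuous p}.
  move=> sh; apply: derivable_within_continuous => s; rewrite in_itv/= => /sh/isd.
  by move=> [].
have [h_ge0|h_lt0] := leP 0 h.
  have sh s : 0 <= s <= h -> `|s| <= `|h|.
    by move=> /andP[s0 ?]; rewrite !ger0_norm.
  have [s| |s + E] := @MVT_segment _ p dp 0 h h_ge0.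
  - by rewrite in_itv/= => /andP[/ltW s0 /ltW s1]; apply: isd (sh s _); rewrite s0.
  - exact: ctn.
  - rewrite in_itv/= => s01; exists s; first exact: sh.
    by move: E; rewrite /p /dp subr0 scale0r addr0 mulrC.
have sh s : h <= s <= 0 -> `|s| <= `|h|.
  by move=> /andP[? s0]; rewrite !ler0_norm ?lerN2// ltW.
have [s| |s + E] := @MVT_segment _ p dp h 0 (ltW h_lt0).
- by rewrite in_itv/= => /andP[/ltW s0 /ltW s1]; apply: isd (sh s _); rewrite s0.
- exact: ctn.
- rewrite in_itv/= => s01; exists s; first exact: sh.
  move: E; rewrite /p /dp sub0r scale0r addr0 => /eqP.
  by rewrite mulrN -eqr_oppLR opprB mulrC => /eqP.
Qed.

(** One direction at a time: additivity in v is not built in, it is the content of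
    [derive_lincomb]. *)
Definition C1_on U g := forall z, U z -> forall v,
  derivable g z v /\ {for z, continuous ('D_v g)}.

Lemma C1_on_near U g a v (e : R) : open U -> C1_on U g -> U a -> 0 < e ->
  exists2 r : R, 0 < r & forall z, `|z| < r ->
    U (a + z) /\ `|'D_v g a - 'D_v g (a + z)| < e.
Proof.
move=> oU Cg Ua e0; have [_ /cvgrPdist_lt/(_ _ e0) H] := Cg _ Ua v.
have /nbhs_ballP[r /= r0 rP] : nbhs a [set z | U z /\ `|'D_v g a - 'D_v g z| < e].
  by apply: filterI H; exact: open_nbhs_nbhs.
exists r => // z zr; apply: rP.
by rewrite -ball_normE /= opprD addNKr normrN.
Qed.

(** The increment along h (c v + d w) is split into a leg along v and a leg along w. The mean value
    theorem on each leg gives derivatives at points near a, and continuity compares them with those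
    at a. *)
Lemma derive_lincomb U g a v w (c d : R) : open U -> C1_on U g -> U a ->
  'D_(c *: v + d *: w) g a = c * 'D_v g a + d * 'D_w g a.
Proof.
move=> oU Cg Ua; apply: cvg_lim => //.
apply/cvgrPdist_lt => e e0.
pose e' := e / (`|c| + `|d| + 1).
have e'0 : 0 < e' by rewrite divr_gt0// ltr_wpDl// addr_ge0.
have [r1 r10 P1] := C1_on_near v oU Cg Ua e'0.
have [r2 r20 P2] := C1_on_near w oU Cg Ua e'0.
(* Both legs stay within distance |h| k of a. *)
pose k := `|c| * `|v| + `|d| * `|w| + 1.
have k0 : 0 < k by rewrite ltr_wpDl// addr_ge0// mulr_ge0.
near=> h.
have h0 : h != 0 by near: h; exact: nbhs_dnbhs_neq.
have hk (x y : R) : `|x| <= `|h * c| -> `|y| <= `|h * d| ->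
    `|x *: v + y *: w| < Num.min r1 r2.
  move=> xh yh; apply: le_lt_trans (ler_normD _ _) _; rewrite !normrZ.
  apply: (@le_lt_trans _ _ (`|h| * k)).
    rewrite /k !mulrDr !mulrA -!normrM mulr1.
    by rewrite ler_wpDr// lerD// ler_wpM2r.
  rewrite -ltr_pdivlMr//; near: h; apply: dnbhs0_lt.
  by rewrite divr_gt0// lt_min r10.
have hk1 (x : R) : `|x| <= `|h * c| -> `|x *: v| < Num.min r1 r2.
  by move=> xh; have := hk x 0 xh; rewrite scale0r addr0 normr0; apply.
have [x xh Ex] : exists2 x : R, `|x| <= `|h * c| &
    g (a + (h * c) *: v) - g a = h * c * 'D_v g (a + x *: v).
  apply: MVT_line => x /hk1; rewrite lt_min => /andP[/P1[Ux _] _].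
  by have [] := Cg _ Ux v.
have [y yh Ey] : exists2 y : R, `|y| <= `|h * d| &
    g (a + (h * c) *: v + (h * d) *: w) - g (a + (h * c) *: v) =
    h * d * 'D_w g (a + (h * c) *: v + y *: w).
  apply: MVT_line => y yh; have := hk _ _ (lexx _) yh.
  by rewrite lt_min => /andP[/P1[/Cg/(_ w)[+ _] _] _]; rewrite addrA.
have := hk1 _ xh; rewrite lt_min => /andP[/P1[_ {}P1] _].
have := hk _ _ (lexx _) yh; rewrite lt_min => /andP[_ /P2[_ {}P2]].
rewrite addrA in P2.
rewrite (_ : _ *: _ = c * 'D_v g (a + x *: v) +
    d * 'D_w g (a + (h * c) *: v + y *: w)); last first.
  apply: (mulfI h0); rewrite [LHS]mulVKf// mulrDr !mulrA -Ex -Ey /=.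
  rewrite (_ : h *: _ + a = a + (h * c) *: v + (h * d) *: w); first by ring.
  by rewrite scalerDr !scalerA addrC addrA.
rewrite opprD addrACA -!mulrBr.
apply: le_lt_trans (ler_normD _ _) _; rewrite !normrM.
apply: (@le_lt_trans _ _ ((`|c| + `|d|) * e')).
  by rewrite mulrDl lerD// ler_wpM2l// ltW.
by rewrite /e' mulrA ltr_pdivrMr ?ltr_wpDl ?addr_ge0// mulrC ltr_pM2l// ltrDl.
Unshelve. all: by end_near. Qed.

(** Mean value theorem twice: along v for z |-> g (z + h w) - g z, and along w for the derivative of
    g along v. *)
Lemma second_difference U g a v w (h : R) : C1_on U g -> C1_on U ('D_v g) ->
  (forall x y : R, `|x| <= `|h| -> `|y| <= `|h| -> U (a + x *: v + y *: w)) ->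
  exists2 p : R * R, `|p.1| <= `|h| /\ `|p.2| <= `|h| &
   (g (a + h *: v + h *: w) - g (a + h *: v)) - (g (a + h *: w) - g a) =
   h * (h * 'D_w ('D_v g) (a + p.1 *: v + p.2 *: w)).
Proof.
move=> Cg Cv HU.
have HU0 (x : R) : `|x| <= `|h| -> U (a + x *: v).
  by move=> xh; have := HU x 0 xh; rewrite normr0 scale0r addr0; apply.
have dg z : U (z + h *: w) -> U z ->
    is_derive z v (fun z => g (z + h *: w) - g z) ('D_v g (z + h *: w) - 'D_v g z).
  move=> Uzw Uz; apply: is_deriveB.
    split; last exact: derive_translate.
    by apply: derivable_translate; have [] := Cg _ Uzw v.
  by apply/derivableP; have [] := Cg _ Uz v.
have [s sh|x xh Ex] := @MVT_line (fun z => g (z + h *: w) - g z) a v h.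
  by have [] := dg _ (HU _ _ sh (lexx _)) (HU0 _ sh).
have [s sh|y yh Ey] := @MVT_line ('D_v g) (a + x *: v) w h.
  by have [] := Cv _ (HU _ _ xh sh) w.
exists (x, y) => //=; rewrite Ex -Ey.
by have [_ ->] := dg _ (HU _ _ xh (lexx _)) (HU0 _ xh).
Qed.

(** The second difference is symmetric in v and w, so the two mixed derivatives agree at a pair of
    points close to a; continuity brings both points to a. *)
Lemma derive_comm U g a v w : open U -> C1_on U g ->
  C1_on U ('D_v g) -> C1_on U ('D_w g) -> U a ->
  'D_v ('D_w g) a = 'D_w ('D_v g) a.
Proof.
move=> oU Cg Cv Cw Ua; apply/eqP; rewrite -subr_eq0 -normr_le0.
apply/ler_addgt0Pr => e e0; rewrite add0r.
have e20 : 0 < e / 2 by rewrite divr_gt0.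
have [r1 r10 P1] := C1_on_near v oU Cw Ua e20.
have [r2 r20 P2] := C1_on_near w oU Cv Ua e20.
pose k := `|v| + `|w| + 1.
have k0 : 0 < k by rewrite ltr_wpDl// addr_ge0.
have m0 : 0 < Num.min r1 r2 by rewrite lt_min r10.
pose h := Num.min r1 r2 / k / 2.
have h0 : 0 < h by rewrite !divr_gt0.
have hk (x y : R) : `|x| <= `|h| -> `|y| <= `|h| ->
    `|x *: v + y *: w| < Num.min r1 r2.
  move=> xh yh; apply: le_lt_trans (ler_normD _ _) _; rewrite !normrZ.
  apply: (@le_lt_trans _ _ (`|h| * (`|v| + `|w|))).
    by rewrite mulrDr lerD// ler_wpM2r.
  have : h * k < Num.min r1 r2.
    by rewrite /h mulrAC divfK ?gt_eqF// ltr_pdivrMr// ltr_pMr ?ltr1n.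
  by apply: le_lt_trans; rewrite gtr0_norm// ler_pM2l// lerDl.
have HU (x y : R) : `|x| <= `|h| -> `|y| <= `|h| -> U (a + x *: v + y *: w).
  move=> xh yh; rewrite -addrA; apply: (P1 _ _).1.
  by have := hk _ _ xh yh; rewrite lt_min => /andP[].
have [[x y] /= [xh yh] E1] := second_difference Cg Cv HU.
have [|[x' y'] /= [xh' yh'] E2] := @second_difference U g a w v h Cg Cw.
  by move=> x' y' xh' yh'; rewrite addrAC; exact: HU.
rewrite (addrAC a (h *: w)) in E2.
have E (b c d f A B : R) : b - c - (d - f) = h * (h * A) ->
    b - d - (c - f) = h * (h * B) -> A = B.
  move=> EA EB; have hn0 : h != 0 by rewrite gt_eqF.
  by apply: (mulfI hn0); apply: (mulfI hn0); rewrite -EA -EB; ring.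
have {E1 E2}E := E _ _ _ _ _ _ E1 E2.
have := hk _ _ yh' xh'; rewrite lt_min => /andP[/P1[_ {}P1] _].
have := hk _ _ xh yh; rewrite lt_min => /andP[_ /P2[_ {}P2]].
rewrite addrA E in P2; rewrite addrA addrAC in P1.
rewrite (splitr e); apply/ltW; apply: le_lt_trans (ltrD P1 P2).
by rewrite [X in _ <= _ + X]distrC; exact: ler_distD.
Qed.

(** Subtracting the quadratic with second derivative M leaves a function q of s with q' <= 0 on
    [0, 1], so q 1 <= q 0. Only an upper bound is required to compare u with its circle means. *)
Lemma taylor2_le g a v (M : R) :
  (forall s : R, `|s| <= 1 -> derivable g (a + s *: v) v /\
     derivable ('D_v g) (a + s *: v) v) ->
  (forall s : R, `|s| <= 1 -> 'D_v ('D_v g) (a + s *: v) <= M) ->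
  g (a + v) <= g a + 'D_v g a + M / 2.
Proof.
move=> dg gM.
pose q (s : R) := g (a + s *: v) - 'D_v g a * s - M / 2 * s ^+ 2.
pose dq (s : R) := 'D_v g (a + s *: v) - 'D_v g a - s * M.
have isq (s : R) : `|s| <= 1 -> is_derive s 1 q (dq s).
  move=> s01; have dgs := is_derive_line (dg _ s01).1.
  have qE : q = (fun s => g (a + s *: v)) - 'D_v g a *: (@id R) - (M / 2) *: ((@id R) ^+ 2).
    by apply/funext => t.
  rewrite qE; apply: is_derive_eq; rewrite /dq /= expr1.
  by rewrite /GRing.scale /=; lra.
have s01_norm (s : R) : 0 <= s -> s <= 1 -> `|s| <= 1 by move=> *; rewrite ger0_norm.
have [s| |s + E] := @MVT_segment _ q dq 0 1 ler01.
- by rewrite in_itv/= => /andP[/ltW s0 /ltW s1]; apply: isq; exact: s01_norm.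
- apply: derivable_within_continuous => s; rewrite in_itv/= => /andP[s0 s1].
  by have [] := isq _ (s01_norm _ s0 s1).
rewrite in_itv/= => /andP[s0 s1].
suff : q 1 - q 0 <= 0.
  by rewrite /q scale1r scale0r addr0 expr1n expr0n/=; lra.
rewrite E subr0 mulr1 /dq.
have [x xs|x xs ->] := @MVT_line ('D_v g) a v s.
  by have [] := dg x (le_trans xs (s01_norm _ s0 s1)).
by rewrite -mulrBr mulr_ge0_le0// subr_le0 gM// (le_trans xs)// s01_norm.
Qed.

End directional_derivatives.

(** * Plurisubharmonicity and the complex Hessian *)

Section circle_means.
Context (R : realType).
Local Notation mu := (@lebesgue_measure R).

(** Over a period the linear and mixed terms integrate to 0 and the two squares to pi. The integrand
    is the second order majorant of u on a small circle; its continuity is returned for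
    integrability. *)
Lemma integral_trig_quadratic (K A B P Q S : R) :
  (\int[mu]_(t in `[0%R, (2 * pi)%R])
     (K + A * cos t + B * sin t + P * (cos t * cos t) + Q * (sin t * cos t)
       + S * (sin t * sin t))%:E = (2 * pi * K + pi * (P + S))%:E)%E /\
  continuous (fun t => K + A * cos t + B * sin t + P * (cos t * cos t) +
     Q * (sin t * cos t) + S * (sin t * sin t)).
Proof.
set f := (X in _ /\ continuous X).
have cf : continuous f.
  move=> t; have hc := @continuous_cos R t; have hs := @continuous_sin R t.
  exact: (cvgD (cvgD (cvgD (cvgD (cvgD (cvg_cst K) (cvgM (cvg_cst A) hc))
    (cvgM (cvg_cst B) hs)) (cvgM (cvg_cst P) (cvgM hc hc)))
    (cvgM (cvg_cst Q) (cvgM hs hc))) (cvgM (cvg_cst S) (cvgM hs hs))).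
split => //.
pose F : R -> R := (K + (P + S) / 2) *: (@id R) + A *: (@sin R) - B *: (@cos R) +
  ((P - S) / 2) *: (@sin R * @cos R) + (Q / 2) *: (@sin R * @sin R).
have isF (t : R) : is_derive t 1 F (f t).
  have hs := is_derive_sin t; have hc := is_derive_cos t.
  have := is_deriveD (is_deriveD (is_deriveB (is_deriveD
     (is_deriveZ (K + (P + S) / 2) (is_derive_id t (1 : R))) (is_deriveZ A hs))
     (is_deriveZ B hc)) (is_deriveZ ((P - S) / 2) (is_deriveM hs hc)))
     (is_deriveZ (Q / 2) (is_deriveM hs hs)).
  move=> H; apply: (is_derive_eq H).
  rewrite /f /GRing.scale /=.
  (* Multiplying the constants by cos^2 + sin^2 leaves an identity of polynomials in c and s. *)
  have -> : K = K * (cos t ^+ 2 + sin t ^+ 2) by rewrite cos2Dsin2 mulr1.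
  have -> : (P + S) / 2 = (P + S) / 2 * (cos t ^+ 2 + sin t ^+ 2) by rewrite cos2Dsin2 mulr1.
  by set c := cos t; set s := sin t; field.
have cF : continuous F.
  by move=> t; apply: differentiable_continuous; apply/derivable1_diffP.
rewrite (@continuous_FTC2 _ f F).
- rewrite -EFinB; congr EFin; rewrite /F.
  rewrite !fctE /GRing.scale /= !mulr_natl cos2pi sin2pi cos0 sin0.
  by field.
- by rewrite mulr_gt0// pi_gt0.
- exact: continuous_subspaceT.
- split; [by move=> t _ | exact/cvg_at_right_filter/cF | exact/cvg_at_left_filter/cF].
- by move=> t _; rewrite derive1E; apply: derive_val.
Qed.

End circle_means.

Section submean.
Context (R : realType) (V : normedModType R).
Local Notation mu := (@lebesgue_measure R).
Variables (U : set V) (u : V -> R).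
Hypotheses (oU : open U) (cu : forall z, U z -> {for z, continuous u}).
Hypotheses (C1u : C1_on U u) (C2u : forall v, C1_on U ('D_v u)).

(** [derive_lincomb] expands the outer derivative only; [derive_comm] exchanges the two so that the
    inner one can be expanded as well. *)
Lemma derive2_lincomb a v w (c d : R) : U a ->
  'D_(c *: v + d *: w) ('D_(c *: v + d *: w) u) a =
  c ^+ 2 * 'D_v ('D_v u) a + c * d * ('D_v ('D_w u) a + 'D_w ('D_v u) a)
  + d ^+ 2 * 'D_w ('D_w u) a.
Proof.
move=> Ua; set e := c *: v + d *: w.
have E1 : 'D_e ('D_e u) a = _ := derive_lincomb v w c d oU (C2u e) Ua.
have Ev := derive_comm oU C1u (C2u v) (C2u e) Ua.
have Ew := derive_comm oU C1u (C2u w) (C2u e) Ua.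
have Evl : 'D_e ('D_v u) a = _ := derive_lincomb v w c d oU (C2u v) Ua.
have Ewl : 'D_e ('D_w u) a = _ := derive_lincomb v w c d oU (C2u w) Ua.
have alg (x y1 y2 z1 z2 A B C D : R) : x = c * y1 + d * y2 -> y1 = z1 -> y2 = z2 ->
    z1 = c * A + d * C -> z2 = c * B + d * D ->
    x = c ^+ 2 * A + c * d * (B + C) + d ^+ 2 * D.
  by move=> -> -> -> -> ->; ring.
exact: alg E1 Ev Ew Evl Ewl.
Qed.

(** The radius is uniform in (c, d): the second derivative is quadratic in (c, d), with four
    continuous coefficients that each contribute at most e / 4. One radius thus serves all points of
    a circle. *)
Lemma derive2_near a v w (e : R) : U a -> 0 < e ->
  exists2 r : R, 0 < r & forall z, `|z| < r -> U (a + z) /\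
    forall c d : R, `|c| <= 1 -> `|d| <= 1 ->
    'D_(c *: v + d *: w) ('D_(c *: v + d *: w) u) (a + z) <=
    'D_(c *: v + d *: w) ('D_(c *: v + d *: w) u) a + e.
Proof.
move=> Ua e0; have e40 : 0 < e / 4 by rewrite divr_gt0.
have [r1 r10 P1] := C1_on_near v oU (C2u v) Ua e40.
have [r2 r20 P2] := C1_on_near v oU (C2u w) Ua e40.
have [r3 r30 P3] := C1_on_near w oU (C2u v) Ua e40.
have [r4 r40 P4] := C1_on_near w oU (C2u w) Ua e40.
exists (Num.min (Num.min r1 r2) (Num.min r3 r4)).
  by rewrite !lt_min r10 r20 r30.
move=> z; rewrite !lt_min -andbA => /and4P[/P1[Uz {}P1] /P2[_ {}P2] /P3[_ {}P3] /P4[_ {}P4]].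
split=> [|c d c1 d1]; first exact: Uz.
rewrite (derive2_lincomb v w c d Uz) (derive2_lincomb v w c d Ua).
have bnd (x y k : R) : `|k| <= 1 -> `|x - y| < e / 4 -> k * y <= k * x + e / 4.
  move=> k1 xy; rewrite -lerBlDl -mulrBr; apply: le_trans (ler_norm _) _.
  by rewrite normrM distrC -[leRHS]mul1r ler_pM// ltW.
have cc : `|c ^+ 2| <= 1 by rewrite normrX expr_le1.
have dd : `|d ^+ 2| <= 1 by rewrite normrX expr_le1.
have cd : `|c * d| <= 1 by rewrite normrM mulr_ile1.
have alg (x1 x2 x3 x4 y1 y2 y3 y4 : R) : `|x1 - y1| < e / 4 ->
    `|x2 - y2| < e / 4 -> `|x3 - y3| < e / 4 -> `|x4 - y4| < e / 4 ->
    c ^+ 2 * y1 + c * d * (y2 + y3) + d ^+ 2 * y4 <=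
    c ^+ 2 * x1 + c * d * (x2 + x3) + d ^+ 2 * x4 + e.
  move=> /(bnd _ _ _ cc) H1 /(bnd _ _ _ cd) H2 /(bnd _ _ _ cd) H3 /(bnd _ _ _ dd) H4.
  by move: H1 H2 H3 H4; clear; lra.
exact: alg P1 P2 P3 P4.
Qed.

(** Averaging the Taylor majorant over a small circle and comparing with u a leaves r^2 / 4 times
    the Laplacian plus e, for arbitrary e > 0. *)
Lemma submean_laplacian_ge0 a v w (r0 : R) : U a -> 0 < r0 ->
  (forall r : R, 0 < r < r0 ->
    ((u a)%:E <= (2 * pi)^-1%:E * \int[mu]_(t in `[0%R, (2 * pi)%R])
       (u (a + ((r * cos t) *: v + (r * sin t) *: w)))%:E)%E) ->
  0 <= 'D_v ('D_v u) a + 'D_w ('D_w u) a.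
Proof.
move=> Ua r00 sub; apply/ler_addgt0Pr => e e0.
have e20 : 0 < e / 2 by rewrite divr_gt0.
have [r1 r10 P1] := derive2_near v w Ua e20.
pose k := `|v| + `|w| + 1.
have k0 : 0 < k by rewrite ltr_wpDl// addr_ge0.
have m0 : 0 < Num.min r0 (r1 / k) by rewrite lt_min r00 divr_gt0.
(* r < r0 makes the sub-mean value inequality available, and r k < r1 keeps the whole disc where
   [P1] controls the second derivatives. *)
pose r := Num.min r0 (r1 / k) / 2.
have r_gt0 : 0 < r by rewrite divr_gt0.
have : r < Num.min r0 (r1 / k) by rewrite ltr_pdivrMr// ltr_pMr ?ltr1n.
rewrite lt_min => /andP[rr0 rr1].
pose p (t : R) := (r * cos t) *: v + (r * sin t) *: w.
have norm_cos (t : R) : `|cos t| <= 1 by rewrite ler_norml cos_geN1 cos_le1.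
have norm_sin (t : R) : `|sin t| <= 1 by rewrite ler_norml sin_geN1 sin_le1.
have pE t : p t = r *: (cos t *: v + sin t *: w).
  by rewrite /p scalerDr !scalerA.
have pr (t s : R) : `|s| <= 1 -> `|s *: p t| < r1.
  move=> s1; rewrite normrZ; apply: (@le_lt_trans _ _ `|p t|).
    by rewrite -[leRHS]mul1r ler_wpM2r.
  rewrite pE normrZ gtr0_norm//.
  apply: (@le_lt_trans _ _ (r * k)); last by rewrite -ltr_pdivlMr.
  rewrite ler_pM2l//; apply: le_trans (ler_normD _ _) _.
  rewrite !normrZ /k ler_wpDr// lerD//.
    by rewrite -[leRHS]mul1r ler_wpM2r.
  by rewrite -[leRHS]mul1r ler_wpM2r.
have U_p t : U (a + p t).
  by rewrite -[p t]scale1r; apply: (P1 _ _).1; apply: pr; rewrite normr1.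
pose Dvv := 'D_v ('D_v u) a; pose Dww := 'D_w ('D_w u) a.
pose Dvw := 'D_v ('D_w u) a + 'D_w ('D_v u) a.
pose f t := (u a + r ^+ 2 * (e / 4)) + (r * 'D_v u a) * cos t + (r * 'D_w u a) * sin t +
  (r ^+ 2 / 2 * Dvv) * (cos t * cos t) + (r ^+ 2 / 2 * Dvw) * (sin t * cos t) +
  (r ^+ 2 / 2 * Dww) * (sin t * sin t).
(* The mean of f over the circle is u a + r^2/4 (Dvv + Dww + e). *)
have u_le t : u (a + p t) <= f t.
  pose q := cos t *: v + sin t *: w.
  have Dp g z : C1_on U g -> U z -> 'D_(p t) g z = r * 'D_q g z.
    move=> Cg Uz; have := derive_lincomb q 0 r 0 oU Cg Uz.
    by rewrite pE scale0r addr0 mul0r addr0.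
  have DDp z : U z -> 'D_(p t) ('D_(p t) u) z = r ^+ 2 * 'D_q ('D_q u) z.
    move=> Uz; have E1 := Dp _ _ (C2u (p t)) Uz; have E3 := Dp _ _ (C2u q) Uz.
    have E2 := derive_comm oU C1u (C2u q) (C2u (p t)) Uz.
    have alg (x1 x2 x3 x4 : R) : x1 = r * x2 -> x2 = x3 -> x3 = r * x4 -> x1 = r ^+ 2 * x4.
      by move=> -> -> ->; rewrite mulrA.
    exact: alg E1 E2 E3.
  have inU (s : R) : `|s| <= 1 -> U (a + s *: p t).
    by move=> /(pr t)/P1[].
  have := @taylor2_le _ _ u a (p t) (r ^+ 2 * ('D_q ('D_q u) a + e / 2)).
  rewrite (Dp _ _ C1u Ua) (derive_lincomb v w (cos t) (sin t) oU C1u Ua).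
  rewrite (derive2_lincomb v w (cos t) (sin t) Ua) => H.
  have alg (b b1 b2 c s x y z : R) :
      b + r * (c * b1 + s * b2) +
        r ^+ 2 * (c ^+ 2 * x + c * s * y + s ^+ 2 * z + e / 2) / 2 <=
      b + r ^+ 2 * (e / 4) + r * b1 * c + r * b2 * s + r ^+ 2 / 2 * x * (c * c) +
      r ^+ 2 / 2 * y * (s * c) + r ^+ 2 / 2 * z * (s * s).
    by clear; rewrite le_eqVlt; apply/orP; left; apply/eqP; field.
  apply: le_trans (alg _ _ _ _ _ _ _ _); apply: H.
  - move=> s /inU Us; split; first by have [] := C1u Us (p t).
    by have [] := C2u (p t) Us (p t).
  - move=> s s1; rewrite (DDp _ (inU _ s1)) ler_pM2l ?exprn_gt0//.
    rewrite -(derive2_lincomb v w (cos t) (sin t) Ua).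
    by have [_ +] := P1 _ (pr t s s1); apply.
have [intf cf] := integral_trig_quadratic (u a + r ^+ 2 * (e / 4)) (r * 'D_v u a)
  (r * 'D_w u a) (r ^+ 2 / 2 * Dvv) (r ^+ 2 / 2 * Dvw) (r ^+ 2 / 2 * Dww).
have := sub r; rewrite r_gt0 => /(_ rr0) {}sub.
have pi_gt0 := pi_gt0 R.
have : ((u a)%:E <= (2 * pi)^-1%:E * (2 * pi * (u a + r ^+ 2 * (e / 4)) +
     pi * (r ^+ 2 / 2 * Dvv + r ^+ 2 / 2 * Dww))%:E)%E.
  apply: le_trans sub _; rewrite lee_pmul2l ?lte_fin ?invr_gt0 ?mulr_gt0// -intf.
  apply: le_integral => //.
  - apply: continuous_compact_integrable; first exact: segment_compact.
    apply: continuous_subspaceT => t.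
    apply: (@continuous_comp _ _ _ (fun t => a + p t) u); last exact: cu.
    apply: cvgD; first exact: cvg_cst.
    have hc := @continuous_cos R t; have hs := @continuous_sin R t.
    exact: (cvgD (cvgZr_tmp (cvgM (cvg_cst r) hc)) (cvgZr_tmp (cvgM (cvg_cst r) hs))).
  - apply: continuous_compact_integrable; first exact: segment_compact.
    exact: continuous_subspaceT.
  - by move=> t _; rewrite lee_fin; exact: u_le.
have mean_alg (q b x y : R) : q != 0 ->
    (2 * q)^-1 * (2 * q * (b + r ^+ 2 * (e / 4)) + q * (r ^+ 2 / 2 * x + r ^+ 2 / 2 * y)) =
    b + r ^+ 2 / 4 * (x + y + e).
  by move=> q0; field.
rewrite -EFinM lee_fin mean_alg ?gt_eqF//.
by rewrite lerDl pmulr_rge0// divr_gt0// exprn_gt0.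
Qed.

End submean.

Section complex_hessian_theory.
Context (R : realType) (n : nat).
Local Notation Cn := 'rV[R]_(n + n).
Local Notation C := R[i].
Variables (U : set Cn) (u : Cn -> R).
Hypotheses (oU : open U) (smu : smooth_on U u).
Local Notation dx j := (real_basis R (lshift n j)).
Local Notation dy j := (real_basis R (rshift n j)).

Lemma smooth_on_C1 (s : seq Cn) : C1_on U (iter_derive s u).
Proof.
move=> z Uz v; have [_ d] := smu s Uz; split; first exact: d.
by have [] := smu (v :: s) Uz.
Qed.

Let C1u : C1_on U u := smooth_on_C1 [::].
Let C2u v : C1_on U ('D_v u) := smooth_on_C1 [:: v].

Lemma wirtinger_barE (k : 'I_n) :
  wirtinger_bar k (fun y => (u y)%:C) =
  (fun y => (2^-1 * 'D_(dx k) u y) +i* (2^-1 * 'D_(dy k) u y)).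
Proof.
apply/funext => y; rewrite /wirtinger_bar /cderive.
rewrite (_ : (fun y0 : Cn => complex.Re (u y0)%:C) = u)//.
rewrite (_ : (fun y0 : Cn => complex.Im (u y0)%:C) = cst 0)//.
rewrite !derive_cst; move: ('D_ _ _ _) ('D_ _ _ _) => a b.
have -> : (2^-1 : C) = (2^-1)%:C by rewrite fmorphV rmorph_nat.
by apply/eqP; rewrite eq_complex /=; apply/andP; split; apply/eqP; ring.
Qed.

Lemma complex_hessianE z j k : U z -> complex_hessian u z j k =
  (4^-1 * ('D_(dx j) ('D_(dx k) u) z + 'D_(dy j) ('D_(dy k) u) z)) +i*
  (4^-1 * ('D_(dx j) ('D_(dy k) u) z - 'D_(dy j) ('D_(dx k) u) z)).
Proof.
move=> Uz; rewrite mxE wirtinger_barE /wirtinger /cderive /=.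
have dE v w : 'D_v (fun y => 2^-1 * 'D_w u y) z = 2^-1 * 'D_v ('D_w u) z.
  by rewrite (@deriveZ _ _ _ ('D_w u) 2^-1 z v)//; have [] := C2u w Uz v.
have alg (a b c d a' b' c' d' : R) :
    a' = 2^-1 * a -> b' = 2^-1 * b -> c' = 2^-1 * c -> d' = 2^-1 * d ->
    2^-1 * ((a' +i* b') - 'i%C * (c' +i* d')) =
    (4^-1 * (a + d)) +i* (4^-1 * (b - c)) :> C.
  move=> -> -> -> ->; have -> : (2^-1 : C) = (2^-1)%:C by rewrite fmorphV rmorph_nat.
  by apply/eqP; rewrite eq_complex /=; apply/andP; split; apply/eqP; field.
by apply: alg; exact: dE.
Qed.

Lemma complex_hessian_herm z : U z ->
  (complex_hessian u z)^T = map_mx Num.conj (complex_hessian u z).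
Proof.
move=> Uz; apply/matrixP => j k; rewrite [LHS]mxE [RHS]mxE !complex_hessianE//.
have cE v w := derive_comm oU C1u (C2u v) (C2u w) Uz.
have alg (a a' b b' c c' d d' : R) : a = a' -> b = b' -> c = d' -> d = c' ->
    (4^-1 * (a + b)) +i* (4^-1 * (c - d)) =
    Num.conj ((4^-1 * (a' + b')) +i* (4^-1 * (c' - d'))).
  move=> -> -> -> ->; apply/eqP; rewrite eq_complex /=.
  by apply/andP; split; apply/eqP; ring.
by apply: alg; exact: cE.
Qed.

Lemma derive_sum_basis g (a b : 'I_n -> R) z : C1_on U g -> U z ->
  'D_(\sum_j (a j *: dx j + b j *: dy j)) g z =
  \sum_j (a j * 'D_(dx j) g z + b j * 'D_(dy j) g z).
Proof.
move=> Cg Uz.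
have d0 : 'D_0 g z = 0.
  by have := derive_lincomb 0 0 0 0 oU Cg Uz; rewrite !scale0r addr0 !mul0r addr0.
elim: (index_enum _) => [|j s IH]; first by rewrite !big_nil.
rewrite !big_cons -IH -(derive_lincomb _ _ _ _ oU Cg Uz).
set v := (a j *: _ + _); set w := \sum_(_ <- s) _.
by have := derive_lincomb v w 1 1 oU Cg Uz; rewrite !scale1r !mul1r.
Qed.

Lemma derive2_sum_basis (a b : 'I_n -> R) z
    (v := \sum_j (a j *: dx j + b j *: dy j)) : U z ->
  'D_v ('D_v u) z =
  \sum_j (a j * \sum_k (a k * 'D_(dx k) ('D_(dx j) u) z + b k * 'D_(dy k) ('D_(dx j) u) z) +
          b j * \sum_k (a k * 'D_(dx k) ('D_(dy j) u) z + b k * 'D_(dy k) ('D_(dy j) u) z)).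
Proof.
move=> Uz; apply: (etrans (derive_sum_basis a b (C2u v) Uz)).
apply: eq_bigr => j _.
have Ex w := etrans (derive_comm oU C1u (C2u w) (C2u v) Uz)
  (derive_sum_basis a b (C2u w) Uz).
by congr (_ * _ + _ * _); exact: Ex.
Qed.

Lemma Re_sum (I : Type) (r : seq I) (F : I -> C) :
  complex.Re (\sum_(i <- r) F i) = \sum_(i <- r) complex.Re (F i).
Proof. by apply: (big_morph (@complex.Re R)) => // -[a b] [c d]. Qed.

(** The algebra of [laplacian_hessianE] with free numbers in place of the second derivatives; it
    holds separately for each pair (j, k). *)
Lemma Re_hermitian_form (xi : 'cV[C]_n) (M : 'M[C]_n)
  (XX YY XY YX : 'I_n -> 'I_n -> R)
  (a := fun j => complex.Re (xi j 0)) (b := fun j => - complex.Im (xi j 0))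
  (S := fun a b : 'I_n -> R =>
     \sum_j (a j * \sum_k (a k * XX k j + b k * YX k j) +
             b j * \sum_k (a k * XY k j + b k * YY k j))) :
  (forall k j, M k j = (4^-1 * (XX k j + YY k j)) +i* (4^-1 * (XY k j - YX k j))) ->
  4^-1 * (S a b + S (fun j => - b j) a) =
  complex.Re (((map_mx Num.conj xi)^T *m M *m xi) 0 0).
Proof.
move=> ME; rewrite mxE Re_sum /S -big_split mulr_sumr; apply: eq_bigr => j _.
rewrite mxE mulr_suml Re_sum !mulr_sumr -!big_split mulr_sumr.
apply: eq_bigr => k _; rewrite !mxE ME /a /b.
by case: (xi k 0) (xi j 0) => [p q] [p' q'] /=; ring.
Qed.

(** The Levi form is a quarter of the Laplacian along a complex line, here spanned by v, with w = i
    v. The direction is the conjugate of xi, hence the sign of b: the Hessian is antiholomorphic in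
    its second index, while the form conjugates xi at the first. *)
Lemma laplacian_hessianE (xi : 'cV[C]_n) z
  (a := fun j => complex.Re (xi j 0)) (b := fun j => - complex.Im (xi j 0))
  (v := \sum_j (a j *: dx j + b j *: dy j))
  (w := \sum_j (- b j *: dx j + a j *: dy j)) : U z ->
  4^-1 * ('D_v ('D_v u) z + 'D_w ('D_w u) z) =
  complex.Re (((map_mx Num.conj xi)^T *m complex_hessian u z *m xi) 0 0).
Proof.
move=> Uz; apply: etrans (Re_hermitian_form xi (fun k j => complex_hessianE k j Uz)).
congr (_ * (_ + _)); exact: derive2_sum_basis.
Qed.

End complex_hessian_theory.

Section psh_hessian.
Context (R : realType) (n : nat).
Local Notation Cn := 'rV[R]_(n + n).
Local Notation C := R[i].
Local Notation dx j := (real_basis R (lshift n j)).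
Local Notation dy j := (real_basis R (rshift n j)).

Lemma sum_basis_lshift (a b : 'I_n -> R) k :
  (\sum_j (a j *: dx j + b j *: dy j)) 0 (lshift n k) = a k.
Proof.
rewrite summxE (bigD1 k)//= big1 => [|j jk]; rewrite !mxE eqxx /=.
  by rewrite eqxx eq_lrshift mulr1 mulr0 !addr0.
by rewrite eq_lshift eq_lrshift eq_sym (negPf jk) !mulr0 addr0.
Qed.

Lemma sum_basis_rshift (a b : 'I_n -> R) k :
  (\sum_j (a j *: dx j + b j *: dy j)) 0 (rshift n k) = b k.
Proof.
rewrite summxE (bigD1 k)//= big1 => [|j jk]; rewrite !mxE eqxx /=.
  by rewrite eqxx eq_rlshift mulr1 mulr0 add0r addr0.
by rewrite eq_rshift eq_rlshift eq_sym (negPf jk) !mulr0 addr0.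
Qed.

(** The second vector is i times the first. This turns the discs in [psh] into the circles of
    [submean_laplacian_ge0]. *)
Lemma complex_scale_sum_basis (a b : 'I_n -> R) (r : R) (lambda : C) :
  complex_scale lambda (r *: \sum_j (a j *: dx j + b j *: dy j)) =
  (r * complex.Re lambda) *: (\sum_j (a j *: dx j + b j *: dy j)) +
  (r * complex.Im lambda) *: (\sum_j (- b j *: dx j + a j *: dy j)).
Proof.
case: lambda => p q /=.
have vl := sum_basis_lshift a b; have vr := sum_basis_rshift a b.
have wl := sum_basis_lshift (fun j => - b j) a.
have wr := sum_basis_rshift (fun j => - b j) a.
move: (\sum_j (a j *: _ + _)) (\sum_j (- b j *: _ + _)) vl vr wl wr => v w vl vr wl wr.
apply/rowP => i; rewrite /complex_scale /rV_of_cplx [RHS]mxE.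
by have [k ->|k ->] := split_ordP i;
  rewrite ?row_mxEl ?row_mxEr !mxE /= vl vr ?wl ?wr; ring.
Qed.

Variables (U Omega : set Cn) (u : Cn -> R).
Hypotheses (oU : open U) (smu : smooth_on U u).
Hypotheses (oO : open Omega) (OU : closure Omega `<=` U).
Hypothesis (pshu : psh Omega (EFin \o u)).

Lemma psh_hessian_form_ge0 (xi : 'cV[C]_n) z : Omega z ->
  0 <= complex.Re (((map_mx Num.conj xi)^T *m complex_hessian u z *m xi) 0 0).
Proof.
move=> Oz; have Uz : U z by apply/OU/subset_closure.
rewrite -(laplacian_hessianE oU smu xi Uz).
set v := \sum_j _; set w := \sum_j _.
rewrite mulr_ge0 ?invr_ge0//.
have /nbhs_ballP[e /= e0 eO] := open_nbhs_nbhs (conj oO Oz).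
pose k := `|v| + `|w| + 1.
have k0 : 0 < k by rewrite ltr_wpDl// addr_ge0.
apply: (@submean_laplacian_ge0 _ _ U u oU _ _ _ z v w (e / k) Uz).
- by move=> y Uy; have [] := smu [::] Uy.
- exact: (smooth_on_C1 smu [::]).
- by move=> y; exact: (smooth_on_C1 smu [:: y]).
- by rewrite divr_gt0.
move=> r /andP[r0 re].
have := pshu.2 z (r *: v).
under eq_integral do rewrite complex_scale_sum_basis /=.
apply=> lambda l1; apply: eO; rewrite -ball_normE /= opprD addNKr normrN.
rewrite complex_scale_sum_basis -/v -/w.
have sq1 : complex.Re lambda ^+ 2 + complex.Im lambda ^+ 2 <= 1.
  by rewrite -lecR add_Re2_Im2 expr_le1.
have Re1 : `|complex.Re lambda| <= 1.
  rewrite -(@expr_le1 _ 2)// -normrX ger0_norm ?sqr_ge0//.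
  by apply: le_trans sq1; rewrite lerDl sqr_ge0.
have Im1 : `|complex.Im lambda| <= 1.
  rewrite -(@expr_le1 _ 2)// -normrX ger0_norm ?sqr_ge0//.
  by apply: le_trans sq1; rewrite lerDr sqr_ge0.
apply: le_lt_trans (ler_normD _ _) _; rewrite !normrZ (gtr0_norm r0).
rewrite -!mulrA -mulrDr; apply: (@le_lt_trans _ _ (r * k)); last first.
  by rewrite -ltr_pdivlMr.
rewrite ler_pM2l// /k ler_wpDr// lerD//.
  by rewrite -[leRHS]mul1r ler_wpM2r.
by rewrite -[leRHS]mul1r ler_wpM2r.
Qed.

Lemma continuous_laplacian (v w z : Cn) : U z ->
  {for z, continuous (fun z => 4^-1 * ('D_v ('D_v u) z + 'D_w ('D_w u) z))}.
Proof.
move=> Uz; have [cv _] := smu [:: v; v] Uz; have [cw _] := smu [:: w; w] Uz.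
exact: (cvgM (cvg_cst (4^-1 : R)) (cvgD cv cw)).
Qed.

Lemma psdmx_complex_hessian z : closure Omega z -> psdmx (complex_hessian u z).
Proof.
move=> Oz; have Uz := OU Oz.
have herm := complex_hessian_herm oU smu Uz; split => // xi.
set q := (_ *m xi) 0 0.
have q_real : Num.conj q = q.
  have : map_mx Num.conj ((map_mx Num.conj xi)^T *m complex_hessian u z *m xi)^T =
      (map_mx Num.conj xi)^T *m complex_hessian u z *m xi.
    move: (complex_hessian u z) herm => H herm.
    have a1 : map_mx Num.conj (map_mx Num.conj xi)^T^T = xi.
      by apply/matrixP => i j; rewrite trmxK !mxE conjCK.
    have a2 : map_mx Num.conj H^T = H.
      by apply/matrixP => i j; rewrite herm !mxE conjCK.
    by rewrite !trmx_mul !map_mxM /= a1 a2 -map_trmx mulmxA.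
  by move=> /matrixP/(_ 0 0); rewrite [LHS]mxE [(_^T) 0 0]mxE.
suff : 0 <= complex.Re q by rewrite -lecR RRe_real//; apply/CrealP.
rewrite leNgt; apply/negP => q0.
pose v := \sum_j (complex.Re (xi j 0) *: dx j + - complex.Im (xi j 0) *: dy j).
pose w := \sum_j (- - complex.Im (xi j 0) *: dx j + complex.Re (xi j 0) *: dy j).
(* Continuity is immediate for this expression in iterated derivatives, so a negative value at z
   persists nearby, where Omega is met. *)
pose L y := 4^-1 * ('D_v ('D_v u) y + 'D_w ('D_w u) y).
have LE y : U y -> L y =
    complex.Re (((map_mx Num.conj xi)^T *m complex_hessian u y *m xi) 0 0).
  by move=> Uy; exact: (laplacian_hessianE oU smu xi Uy).
have near_lt : \forall y \near z, L y < 0.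
  by apply: (cvgr_lt (L z) (@continuous_laplacian v w z Uz)); rewrite LE.
have [y [Oy [Uy]]] : (Omega `&` (U `&` [set y | L y < 0])) !=set0.
  by apply: Oz; apply: filterI near_lt; exact: open_nbhs_nbhs.
by rewrite /= LE// ltNge psh_hessian_form_ge0.
Qed.

End psh_hessian.

(** * Integration against measure coefficients *)

Section bounded_functionals.
Context d (T : measurableType d) (R : realType) (K : set T).
Hypothesis mK : measurable K.
Implicit Types (g : T -> R) (Phi : (T -> R) -> R).

Definition bounded_measurable g :=
  measurable_fun K g /\ exists M, forall z, K z -> `|g z| <= M.

(** A common interface for integration against a charge and against a density; B plays the role of
    the total variation on K. *)
Definition bounded_functional Phi :=
  (forall c g1 g2, bounded_measurable g1 -> bounded_measurable g2 ->
     Phi (fun z => c * g1 z + g2 z) = c * Phi g1 + Phi g2) /\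
  exists2 B, 0 <= B & forall g M, bounded_measurable g ->
     (forall z, K z -> `|g z| <= M) -> `|Phi g| <= B * M.

Lemma bounded_measurable_cst (r : R) : bounded_measurable (fun=> r).
Proof. by split; [exact: measurable_cst | exists `|r|]. Qed.

Lemma bounded_measurable_indic (A : set T) :
  measurable A -> bounded_measurable (\1_A : T -> R).
Proof.
move=> mA; split.
  by apply: measurable_funTS; exact: measurable_indic.
by exists 1 => z _; rewrite indicE; case: (z \in A); rewrite ?normr1 ?normr0.
Qed.

Lemma bounded_measurable_lincomb c g1 g2 :
  bounded_measurable g1 -> bounded_measurable g2 ->
  bounded_measurable (fun z => c * g1 z + g2 z).
Proof.
move=> [m1 [M1 b1]] [m2 [M2 b2]]; split.
  by apply: measurable_funD => //; apply: measurable_funM => //; exact: measurable_cst.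
exists (`|c| * M1 + M2) => z Kz; apply: le_trans (ler_normD _ _) _.
by rewrite normrM lerD// ?b2// ler_wpM2l// b1.
Qed.

Lemma bounded_measurable_sum (I : Type) (s : seq I) (c : I -> R) (f : I -> T -> R) :
  (forall i, bounded_measurable (f i)) ->
  bounded_measurable (fun z => \sum_(i <- s) c i * f i z).
Proof.
move=> bf; elim: s => [|i s IH].
  under eq_fun do rewrite big_nil; exact: bounded_measurable_cst.
by under eq_fun do rewrite big_cons; exact: bounded_measurable_lincomb.
Qed.

Lemma bounded_functional_sum Phi (I : Type) (s : seq I) (c : I -> R)
    (f : I -> T -> R) : bounded_functional Phi ->
  (forall i, bounded_measurable (f i)) ->
  Phi (fun z => \sum_(i <- s) c i * f i z) = \sum_(i <- s) c i * Phi (f i).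
Proof.
move=> [lin _] bf; elim: s => [|i s IH].
  rewrite big_nil; under eq_fun do rewrite big_nil.
  have E : (fun z : T => -1 * 0 + 0) = (fun=> 0) :> (T -> R).
    by apply/funext => z; rewrite mulr0 addr0.
  (* Linearity with c = -1 at the zero functions gives Phi 0 = - Phi 0 + Phi 0. *)
  have := lin (-1) _ _ (bounded_measurable_cst 0) (bounded_measurable_cst 0).
  by rewrite E => /eqP; rewrite mulN1r addNr => /eqP.
under eq_fun do rewrite big_cons.
by rewrite lin//; [rewrite IH big_cons | exact: bounded_measurable_sum].
Qed.

Lemma bounded_functional_lincomb Phi Psi (c : R) :
  bounded_functional Phi -> bounded_functional Psi ->
  bounded_functional (fun g => c * Phi g + Psi g).
Proof.
move=> [linP [BP BP0 bP]] [linQ [BQ BQ0 bQ]]; split.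
  by move=> e g1 g2 b1 b2; rewrite linP// linQ//; ring.
exists (`|c| * BP + BQ); first by rewrite addr_ge0// mulr_ge0.
move=> g M bg gM; apply: le_trans (ler_normD _ _) _.
by rewrite normrM mulrDl -mulrA lerD// ?bQ// ler_wpM2l// bP.
Qed.

Lemma bounded_functional_integral (m : {measure set T -> \bar R}) (rho : T -> R) :
  m.-integrable K (EFin \o rho) ->
  bounded_functional (fun g => \int[m]_(z in K) (rho z * g z)).
Proof.
move=> irho.
have irhog g : bounded_measurable g ->
    m.-integrable K (EFin \o (fun z => rho z * g z)).
  move=> [mg [M gM]].
  apply: (eq_integrable mK (fun z => (rho z)%:E * (g z)%:E)%E).
    by move=> z _; rewrite /= EFinM.
  apply: (integrableMl mK irho mg).
  exists M; split; first exact: num_real.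
  by move=> N MN z Kz; apply: le_trans (gM _ Kz) (ltW MN).
split.
  move=> c g1 g2 b1 b2; rewrite -RintegralZl ?irhog// -RintegralD ?irhog//.
    by apply: eq_Rintegral => z _; ring.
  rewrite (_ : _ \o _ = EFin \o (fun z => rho z * (c * g1 z + 0))).
    apply: irhog; apply: bounded_measurable_lincomb => //.
    exact: bounded_measurable_cst.
  by apply/funext => z /=; rewrite addr0 mulrCA.
have inorm (h : T -> R) : m.-integrable K (EFin \o h) ->
  m.-integrable K (EFin \o (fun z => `|h z|)) := @integrable_norm _ _ _ m K h.
exists (\int[m]_(z in K) `|rho z|); first exact: Rintegral_ge0.
move=> g M bg gM; apply: le_trans (le_normr_Rintegral _ (irhog _ bg)) _ => //.
rewrite -RintegralZr//; last exact: inorm.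
apply: le_Rintegral => //.
- exact/inorm/irhog.
- apply: (eq_integrable mK (fun z => `|rho z|%:E * M%:E)%E).
    by move=> z _; rewrite /= EFinM.
  exact: (integrableZr mK M (inorm _ irho)).
- by move=> z Kz; rewrite normrM ler_wpM2l// gM.
Qed.

End bounded_functionals.

Section functional_positivity.
Context d (T : measurableType d) (R : realType) (K : set T).
Hypothesis mK : measurable K.

(** Positivity passes from coefficients frozen at one point to variable ones. All g i are frozen at
    the same z, because positivity belongs to the family (the entries of a positive matrix) and not
    to its members. *)
Lemma bounded_functional_sum_ge0 (J : finType) (Phi : J -> (T -> R) -> R)
    (g : J -> T -> R) :
  (forall i, bounded_functional K (Phi i)) ->
  (forall i, bounded_measurable K (g i)) ->
  (forall z A, K z -> measurable A -> A `<=` K ->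
    0 <= \sum_i g i z * Phi i (\1_A)) ->
  0 <= \sum_i Phi i (g i).
Proof.
move=> bPhi bg pos.
have /choice[M gM] : forall i, exists M : R, forall z, K z -> `|g i z| <= M.
  by move=> i; exact: (bg i).2.
have /choice[B] : forall i, exists B : R, 0 <= B /\ forall h (e : R), bounded_measurable K h ->
    (forall z, K z -> `|h z| <= e) -> `|Phi i h| <= B * e.
  by move=> i; have [B] := (bPhi i).2; exists B.
move=> /all_and2[B0 PhiB].
(* Approximating every g i within e costs at most e times the sum of the B i; the + 1 below keeps
   the divisor positive when all bounds vanish. *)
suff ge0 (e : R) : 0 < e -> - (e * \sum_i B i) <= \sum_i Phi i (g i).
  rewrite -oppr_le0; apply/ler_addgt0Pr => e e0; rewrite add0r.
  have S0 : 0 <= \sum_i B i by exact: sumr_ge0.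
  rewrite lerNl; apply: le_trans (ge0 (e / (\sum_i B i + 1)) _); last first.
    by rewrite divr_gt0// ltr_wpDl.
  rewrite lerN2 mulrAC ler_pdivrMr ?ltr_wpDl//.
  by rewrite ler_pM2l// lerDl.
move=> e0.
(* The cells A c, for c a map from J to 'I_N, partition K so that every g i varies
   by at most e on each of them; h i takes on a whole cell the value of g i at one
   point of the cell, which lets the positivity hypothesis apply to it. *)
have [N NM] : exists N : nat, forall i, M i + M i < N%:R * e.
  pose N := Num.bound ((\sum_i `|M i + M i|) / e).
  exists N => i; rewrite -ltr_pdivrMr//.
  apply: le_lt_trans (archi_boundP _); last by rewrite divr_ge0 ?sumr_ge0// ltW.
  rewrite ler_pM2r ?invr_gt0//; apply: le_trans (ler_norm _) _.
  by rewrite (bigD1 i)//= lerDl sumr_ge0.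
(* The cells are half-open, so the strict inequality [NM] is what leaves a cell for the value M
   i. *)
pose lo i (c : 'I_N) := - M i + c%:R * e.
pose A (c : {ffun J -> 'I_N}) :=
  K `&` \bigcap_(i in [set: J]) [set z | K z /\ `[lo i (c i), lo i (c i) + e[%classic (g i z)].
have mA c : measurable (A c).
  apply: measurableI => //; apply: fin_bigcap_measurable => [|i _].
    exact: finite_finset.
  by have [mg _] := bg i; exact: mg mK _ (measurable_itv _).
have AK c : A c `<=` K by move=> z [].
have cell z : K z -> exists c, A c z.
  move=> Kz; pose x i := (g i z + M i) / e.
  have x0 i : 0 <= x i.
    rewrite divr_ge0 ?(ltW e0)//; have := gM i _ Kz.
    by rewrite ler_norml => /andP[]; lra.
  have xN i : (Num.truncn (x i) < N)%N.
    rewrite -(ltr_nat R); have /andP[+ _] := truncn_itv (x0 i).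
    move=> /le_lt_trans; apply; rewrite ltr_pdivrMr//.
    apply: le_lt_trans (NM i); rewrite lerD2r.
    by apply: le_trans (gM i _ Kz); exact: ler_norm.
  exists [ffun i => Ordinal (xN i)]; split => // i _; split => //=.
  rewrite in_itv /= /lo ffunE /=.
  have /andP[] := truncn_itv (x0 i).
  rewrite /x ler_pdivlMr// ltr_pdivrMr// -natr1; lra.
have cell_uniq z c c' : A c z -> A c' z -> c = c'.
  move=> Ac Ac'; apply/ffunP => i; apply/val_inj => /=.
  have {Ac} := Ac.2 i I => -[_ /=]; have {Ac'} := Ac'.2 i I => -[_ /=].
  rewrite !in_itv /= /lo => /andP[H1 H2] /andP[H3 H4].
  have lt_cell (p q : nat) : p%:R * e < q%:R * e + e -> (p <= q)%N.
    by rewrite -[in X in _ < _ + X -> _](mul1r e) -mulrDl ltr_pM2r// natr1 ltr_nat.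
  by apply/eqP; rewrite eqn_leq; apply/andP; split; apply: lt_cell; lra.
(* An empty cell has no sample point; the value 0 makes its contribution vanish. *)
pose r i c := if pselect (A c !=set0) is left h then g i (sval (cid h)) else 0.
pose h i z := \sum_c r i c * \1_(A c) z.
have bh i : bounded_measurable K (h i).
  by apply: bounded_measurable_sum => // c; exact: bounded_measurable_indic.
have PhihE : \sum_i Phi i (h i) = \sum_c \sum_i r i c * Phi i (\1_(A c)).
  rewrite exchange_big; apply: eq_bigr => i _.
  by apply: bounded_functional_sum => // c; exact: bounded_measurable_indic.
have Phih_ge0 : 0 <= \sum_i Phi i (h i).
  rewrite PhihE; apply: sumr_ge0 => c _; rewrite /r.
  case: pselect => [ne|_]; last by rewrite big1// => i _; rewrite mul0r.
  case: cid => z Az /=; exact: pos (AK _ _ Az) (mA c) (@AK c).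
have gh i z : K z -> `|g i z - h i z| <= e.
  move=> Kz; have [c Ac] := cell _ Kz.
  rewrite /h (bigD1 c)//= big1 => [|c' cc']; last first.
    rewrite indicE memNset ?mulr0// => Ac'.
    by move: cc'; rewrite (cell_uniq _ _ _ Ac Ac') eqxx.
  rewrite addr0 indicE mem_set// mulr1 /r.
  case: pselect => [ne|[]]; last by exists z.
  case: cid => y Ay /=.
  move: Ac Ay => [_ /(_ i I)[_ /=]] + [_ /(_ i I)[_ /=]].
  rewrite !in_itv /= => /andP[H1 H2] /andP[H3 H4].
  rewrite ler_norml; lra.
have Phigh i : Phi i (h i) - e * B i <= Phi i (g i).
  have bgh : bounded_measurable K (fun z => -1 * h i z + g i z).
    exact: bounded_measurable_lincomb.
  have := PhiB i _ e bgh; rewrite (bPhi i).1//.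
  have ghe z : K z -> `|-1 * h i z + g i z| <= e.
    by move=> Kz; rewrite mulN1r addrC gh.
  move=> /(_ ghe); rewrite ler_norml => /andP[H _].
  by move: H; lra.
apply: le_trans (ler_sum _ (fun i _ => Phigh i)).
by rewrite sumrB mulr_sumr lerBDr addNr.
Qed.

End functional_positivity.

Section integral_sums.
Context d (T : measurableType d) (R : realType) (m : {measure set T -> \bar R}).

Lemma Rintegral_sum (I : Type) (s : seq I) (K : set T) (f : I -> T -> R) :
  measurable K -> (forall i, m.-integrable K (EFin \o f i)) ->
  m.-integrable K (EFin \o (fun z => \sum_(i <- s) f i z)) /\
  \int[m]_(z in K) (\sum_(i <- s) f i z) = \sum_(i <- s) \int[m]_(z in K) f i z.
Proof.
move=> mK fi; elim: s => [|i s [IHi IHe]].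
  split.
    apply: (eq_integrable mK (cst 0%E)); last exact: integrable0.
    by move=> z _; rewrite /= big_nil.
  rewrite big_nil; under eq_Rintegral do rewrite big_nil.
  by rewrite Rintegral_cst// mul0r.
split.
  apply: (eq_integrable mK (fun z => (f i z)%:E + (\sum_(j <- s) f j z)%:E)%E).
    by move=> z _; rewrite /= big_cons EFinD.
  exact: (integrableD mK (fi i) IHi).
rewrite big_cons -IHe -RintegralD//.
by apply: eq_Rintegral => z _; rewrite big_cons.
Qed.

End integral_sums.

Section charge_integrals.
Context (R : realType) (n : nat).
Local Notation Cn := 'rV[R]_(n + n).
Variables (K : set Cn) (mK : measurable K).

(** The Jordan parts of the chosen Hahn decomposition are finite measures whose difference is nu.
    The values on indicators no longer depend on that choice. *)
Lemma bounded_functional_charge_integral (nu : {charge set Cn -> \bar R}) :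
  bounded_functional K (charge_integral nu K) /\
  forall A, measurable A -> A `<=` K -> charge_integral nu K \1_A = fine (nu A).
Proof.
have [m1 [m2 [E nuE]]] : exists m1 m2 : {finite_measure set Cn -> \bar R},
    (forall g, charge_integral nu K g = \int[m1]_(z in K) g z - \int[m2]_(z in K) g z) /\
    forall A, measurable A -> nu A = (m1 A - m2 A)%E.
  rewrite /charge_integral; case: cid => P exN; case: cid => N nuPN.
  exists (jordan_pos nuPN), (jordan_neg nuPN); split => // A mA.
  rewrite (jordan_decomp nuPN mA).
  by rewrite /cadd /= cscaleN1.
have fin_int (m : {finite_measure set Cn -> \bar R}) :
    bounded_functional K (fun g => \int[m]_(z in K) g z).
  have -> : (fun g => \int[m]_(z in K) g z) = fun g => \int[m]_(z in K) (1 * g z).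
    by apply/funext => g; apply: eq_Rintegral => z _; rewrite mul1r.
  apply: (@bounded_functional_integral _ _ _ K mK m (fun=> 1)).
  exact: finite_measure_integrable_cst.
split.
  rewrite (_ : charge_integral nu K =
      fun g => -1 * \int[m2]_(z in K) g z + \int[m1]_(z in K) g z).
    exact: bounded_functional_lincomb (fin_int m2) (fin_int m1).
  by apply/funext => g; rewrite E mulN1r addrC.
move=> A mA AK; rewrite E /Rintegral !integral_indic// !setIidl// nuE//.
by rewrite fineB// fin_num_measure.
Qed.

End charge_integrals.

(** * Pairing a positive current with a positive (1,1)-form *)

Section current_trace.
Context (R : realType) (n : nat).
Local Notation Cn := 'rV[R]_(n + n).
Local Notation C := R[i].
Local Notation dV := (lebesgue_rV R (n + n)).
Variables (K : set Cn) (T : current R n) (Theta a : Cn -> 'M[C]_n).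
Hypotheses (mK : measurable K) (posT : positive_current T) (acT : ac_density T Theta).
Hypothesis psd_a : forall z, K z -> psdmx (a z).
Hypothesis Re_a : forall j k, bounded_measurable K (fun z => complex.Re (a z j k)).
Hypothesis Im_a : forall j k, bounded_measurable K (fun z => complex.Im (a z j k)).

(** T minus Theta dV is viewed as a finite family of real functionals for
    [bounded_functional_sum_ge0]. With a frozen at z and tested on a set A, the claim is
    [psdmx_trace_ge0] for the matrix a z and the numbers S k j (A). *)
Lemma le_current_pairing :
  dV.-integrable K (EFin \o (fun z => complex.Re (\tr (a z *m Theta z)))) /\
  \int[dV]_(z in K) complex.Re (\tr (a z *m Theta z))
    <= complex.Re (current_pairing K T a).
Proof.
have [iRe iIm [S [N [mN N0 ST]]]] := acT.
have integrable_prod (rho g : Cn -> R) : dV.-integrable setT (EFin \o rho) ->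
    bounded_measurable K g -> dV.-integrable K (EFin \o (fun z => rho z * g z)).
  move=> irho [mg [M gM]].
  apply: (eq_integrable mK (fun z => (rho z)%:E * (g z)%:E)%E).
    by move=> z _; rewrite /= EFinM.
  have irhoK : dV.-integrable K (EFin \o rho) by exact: integrableS irho.
  apply: (integrableMl mK irhoK mg).
  exists M; split; first exact: num_real.
  by move=> e Me z Kz; apply: le_trans (gM _ Kz) (ltW Me).
(* (j, k, true) and (j, k, false) stand for the real and imaginary parts of the
   (k, j) coefficient of T. Phi integrates against the singular part of T. *)
pose J := ('I_n * 'I_n * bool)%type.
pose rho (p : J) z := if p.2 then complex.Re (Theta z p.1.2 p.1.1)
                      else complex.Im (Theta z p.1.2 p.1.1).
pose nu (p : J) := if p.2 then re_measure (T p.1.2 p.1.1) else im_measure (T p.1.2 p.1.1).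
pose g (p : J) z := if p.2 then complex.Re (a z p.1.1 p.1.2) else complex.Im (a z p.1.1 p.1.2).
(* Signs of Re (a t) = Re a Re t - Im a Im t. *)
pose sg (p : J) : R := if p.2 then 1 else -1.
have irho p : dV.-integrable setT (EFin \o rho p).
  by case: p => [[j k] []]; [exact: iRe | exact: iIm].
have bg p : bounded_measurable K (g p).
  by case: p => [[j k] []]; [exact: Re_a | exact: Im_a].
pose I p h := \int[dV]_(z in K) (rho p z * h z).
pose Phi (p : J) h := if p.2 then -1 * I p h + charge_integral (nu p) K h
                      else -1 * charge_integral (nu p) K h + I p h.
have PhiE p h : Phi p h = sg p * (charge_integral (nu p) K h - I p h).
  by rewrite /Phi /sg; case: p.2; ring.
have bPhi p : bounded_functional K (Phi p).
  have bi : bounded_functional K (I p).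
    apply: (bounded_functional_integral mK).
    exact: (integrableS measurableT mK (@subsetT _ _) (irho p)).
  have bc := (bounded_functional_charge_integral mK (nu p)).1.
  by rewrite /Phi; case: p.2; exact: bounded_functional_lincomb.
have sumJ (F : J -> R) : \sum_p F p = \sum_j \sum_k (F (j, k, true) + F (j, k, false)).
  rewrite pair_bigA /=; rewrite (eq_bigr (fun jk => \sum_(b : bool) F (jk, b))).
    by rewrite pair_bigA; apply: eq_bigr => -[].
  by move=> [j k] _; rewrite big_bool.
have Re_trE z : complex.Re (\tr (a z *m Theta z)) = \sum_p sg p * (rho p z * g p z).
  rewrite sumJ /mxtrace Re_sum; apply: eq_bigr => j _.
  rewrite mxE Re_sum; apply: eq_bigr => k _; rewrite /rho /g /sg /=.
  by case: (a z j k) (Theta z k j) => [? ?] [? ?] /=; ring.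
have pairingE : complex.Re (current_pairing K T a) =
    \sum_p sg p * charge_integral (nu p) K (g p).
  rewrite sumJ /current_pairing Re_sum; apply: eq_bigr => j _.
  by rewrite Re_sum; apply: eq_bigr => k _; rewrite /sg /nu /g /= mul1r mulN1r.
have isum p : dV.-integrable K (EFin \o (fun z => sg p * (rho p z * g p z))).
  apply: (eq_integrable mK (fun z => (sg p)%:E * (rho p z * g p z)%:E)%E).
    by move=> z _; rewrite /= EFinM.
  exact/(integrableZl mK)/integrable_prod.
have [iS ES] := Rintegral_sum (index_enum J) mK isum.
rewrite (_ : (fun z => complex.Re (\tr (a z *m Theta z))) =
  fun z => \sum_p sg p * (rho p z * g p z)); last exact/funext.
split; first exact: iS.
rewrite ES pairingE -subr_ge0 -sumrB.
suff : 0 <= \sum_p Phi p (g p).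
  rewrite (eq_bigr (fun p => sg p * charge_integral (nu p) K (g p) -
     \int[dV]_(z in K) (sg p * (rho p z * g p z))))// => p _.
  by rewrite RintegralZl ?integrable_prod// PhiE mulrBr.
apply: (bounded_functional_sum_ge0 mK bPhi bg) => z A Kz mA AK.
have Phi1 p : Phi p \1_A = sg p * (fine (nu p A) - \int[dV]_(z in A) rho p z).
  rewrite PhiE (bounded_functional_charge_integral mK (nu p)).2//; congr (_ * (_ - _)).
  rewrite /I -[in RHS](setIidr AK) Rintegral_mkcondr; apply: eq_Rintegral => z' _.
  by rewrite patchE indicE; case: (z' \in A); rewrite ?mulr1 ?mulr0.
have -> : \sum_p g p z * Phi p \1_A = complex.Re (\sum_j \sum_k a z j k * cmeas (S k j) A).
  rewrite sumJ Re_sum; apply: eq_bigr => j _.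
  rewrite Re_sum; apply: eq_bigr => k _.
  have [_] := ST k j A mA; rewrite !Phi1 /g /sg /nu /rho /=.
  case: (a z j k) (cmeas (S k j) A) => [a1 a2] [s1 s2] [-> ->] /=; ring.
have : 0 <= \sum_j \sum_k a z j k * cmeas (S k j) A; last by rewrite lecE => /andP[].
apply: psdmx_trace_ge0 (psd_a Kz) _ => xi.
(* S A = S (A /\ N) = T (A /\ N), intersecting with the null set N on which Theta dV vanishes, so
   positivity of T applies to [A N] together. *)
have mAN : measurable (A `&` N) by exact: measurableI.
have := posT xi mAN; congr (0 <= _).
apply: eq_bigr => j _; apply: eq_bigr => k _; congr (_ * _).
have [-> _] := ST k j A mA.
have [_ ->] := ST k j _ mAN.
have NA0 : dV (A `&` N) = 0%E.
  by apply/eqP; rewrite eq_le measure_ge0 andbT -N0 le_measure ?inE.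
have int0 (h : Cn -> R) : dV.-integrable setT (EFin \o h) ->
    \int[dV]_(z in A `&` N) h z = 0.
  move=> /(integrableS measurableT mAN (@subsetT _ _))/measurable_int mh.
  by rewrite /Rintegral null_set_integral.
rewrite (int0 _ (iRe k j)) (int0 _ (iIm k j)).
by case: (cmeas _ _) => s t; apply/eqP; rewrite eq_complex /= !add0r !eqxx.
Qed.

End current_trace.

(** * Measurability and boundedness of the integrands *)

Section continuous_bounded_measurable.
Context (R : realType) (m : nat).
Local Notation V := 'rV[R]_m.
Implicit Types (U K : set V) (h : V -> R).

Lemma open_measurable_rV U : open U -> measurable U.
Proof. by move=> oU; exact: sub_sigma_algebra. Qed.

Lemma closed_measurable_rV K : closed K -> measurable K.
Proof.
move=> cK; rewrite -[K]setCK; apply: measurableC.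
by apply: open_measurable_rV; exact: closed_openC.
Qed.

Lemma continuous_measurable_rV U h : open U ->
  (forall z, U z -> {for z, continuous h}) -> measurable_fun U h.
Proof.
move=> oU ch; have mU := open_measurable_rV oU.
apply: (@measurability _ _ _ (measurableTypeR R) _ _ _ (RGenOInfty.measurableE R)).
move=> _ [_ [x ->] <-]; apply: open_measurable_rV.
have : open (U `&` h @^-1` `]x, +oo[ : set V); last by [].
rewrite openE => z [Uz hz]; apply: filterI; first exact: open_nbhs_nbhs.
by apply: ch => //; apply: open_nbhs_nbhs; split; [exact: interval_open|exact: hz].
Qed.

Lemma continuous_bounded_measurable U K h : open U -> compact K -> K `<=` U ->
  (forall z, U z -> {for z, continuous h}) -> bounded_measurable K h.
Proof.
move=> oU cK KU ch; split.
  by apply: measurable_funS KU (continuous_measurable_rV oU ch); exact: open_measurable_rV.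
have chK : {within K, continuous (fun z => `|h z|)}.
  apply: continuous_in_subspaceT => z; rewrite inE => /KU/ch hz.
  exact: (cvg_norm hz).
have [->|K0] := eqVneq K set0; first by exists 0.
have [|c _ cmax] := @EVT_max_rV _ _ (fun z => `|h z|) K _ cK chK; first exact/set0P.
by exists `|h c| => z Kz; apply: cmax; rewrite inE.
Qed.

End continuous_bounded_measurable.

Section measurable_det.
Context d (T : measurableType d) (R : realType) (D : set T).
Local Notation C := R[i].

Definition cmeasurable (h : T -> C) :=
  measurable_fun D (fun z => complex.Re (h z)) /\
  measurable_fun D (fun z => complex.Im (h z)).

Lemma cmeasurable_cst (c : C) : cmeasurable (fun=> c).
Proof. by split; exact: measurable_cst. Qed.

Lemma cmeasurableD (g h : T -> C) :
  cmeasurable g -> cmeasurable h -> cmeasurable (fun z => g z + h z).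
Proof.
move=> [gr gi] [hr hi]; split.
  rewrite (_ : (fun z => _) = fun z => complex.Re (g z) + complex.Re (h z)).
    exact: measurable_funD.
  by apply/funext => z; case: (g z) (h z) => [? ?] [? ?].
rewrite (_ : (fun z => _) = fun z => complex.Im (g z) + complex.Im (h z)).
  exact: measurable_funD.
by apply/funext => z; case: (g z) (h z) => [? ?] [? ?].
Qed.

Lemma cmeasurableM (g h : T -> C) :
  cmeasurable g -> cmeasurable h -> cmeasurable (fun z => g z * h z).
Proof.
move=> [gr gi] [hr hi]; split.
  rewrite (_ : (fun z => _) = fun z => complex.Re (g z) * complex.Re (h z)
      - complex.Im (g z) * complex.Im (h z)).
    by apply: measurable_funB; exact: measurable_funM.
  by apply/funext => z; case: (g z) (h z) => [? ?] [? ?].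
rewrite (_ : (fun z => _) = fun z => complex.Re (g z) * complex.Im (h z)
    + complex.Im (g z) * complex.Re (h z)).
  by apply: measurable_funD; exact: measurable_funM.
by apply/funext => z; case: (g z) (h z) => [? ?] [? ?].
Qed.

Lemma cmeasurable_det n (A : T -> 'M[C]_n) :
  (forall j k, cmeasurable (fun z => A z j k)) -> cmeasurable (fun z => \det (A z)).
Proof.
move=> mA; rewrite /determinant.
elim: (index_enum _) => [|s r IH].
  by under eq_fun do rewrite big_nil; exact: cmeasurable_cst.
under eq_fun do rewrite big_cons.
apply: cmeasurableD IH; apply: cmeasurableM; first exact: cmeasurable_cst.
elim: (index_enum _) => [|j q IH].
  by under eq_fun do rewrite big_nil; exact: cmeasurable_cst.
by under eq_fun do rewrite big_cons; exact: cmeasurableM.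
Qed.

End measurable_det.

Theorem proposition5p5 (R : realType) (kappa : R) (kappa_gt0 : 0 < kappa) :
  exists2 c : R, 0 < c &
  forall (n : nat) (Omega : set 'rV[R]_(n + n)) (x : 'rV[R]_(n + n))
    (mu : probability 'rV[R]_(n + n) R) (f : 'rV[R]_(n + n) -> R)
    (T : current R n) (Theta : 'rV[R]_(n + n) -> 'M[R[i]]_n),
    (0 < n)%N ->
    open Omega -> connected Omega -> bounded_set Omega -> Omega x ->
    jensen_boundary Omega x mu ->
    {within closure Omega, continuous f} ->
    (forall z, closure Omega z -> 0 <= f z) ->
    positive_current T ->
    supported_in (closure Omega) T ->
    (forall phi : 'rV[R]_(n + n) -> R, smooth_near (closure Omega) phi ->
      (\int[mu]_(z in boundary Omega) phi z - phi x)%:C =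
        current_pairing (closure Omega) T (ddc kappa phi)) ->
    (forall z, psdmx (Theta z)) ->
    ac_density T Theta ->
    forall u : 'rV[R]_(n + n) -> R,
      smooth_near (closure Omega) u -> psh Omega (EFin \o u) ->
      (forall z, Omega z -> (f z)%:C <= form11_top (ddc kappa u z)) ->
      (c%:E * \int[lebesgue_rV R (n + n)]_(z in Omega)
                (f z `^ n%:R^-1 * complex.Re (\det (Theta z)) `^ n%:R^-1)%:E
       <= (\int[mu]_(z in boundary Omega) u z - u x)%:E)%E.
Proof.
exists 2^-1; first by rewrite invr_gt0.
move=> n Omega x mu f T Theta n_gt0 oO _ bO _ _ cf f_ge0 posT _ testT psdTheta acT u
  [U [oU OU smu]] pshu MA.
set K := closure Omega.
have cK : compact K.
  apply: bounded_closed_compact; last exact: closed_closure.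
  have [M [Mreal OM]] := bO; exists M; split=> // N MN.
  have cN : closed [set z : 'rV[R]_(n + n) | `|z| <= N].
    apply: (@closed_comp _ _ (fun z : 'rV[R]_(n + n) => `|z|) [set r | r <= N]).
      by move=> z _; exact: norm_continuous.
    exact: closed_le.
  move=> z Kz; apply: cN => B /Kz[y [Oy By]]; exists y; split => //.
  exact: OM Oy.
have mK : measurable K by apply: closed_measurable_rV; exact: closed_closure.
have mO : measurable Omega by exact: open_measurable_rV.
have OK : Omega `<=` K by exact: subset_closure.
have psd_ddc z : K z -> psdmx (ddc kappa u z).
  move=> Kz; apply: psdmx_scale; first exact: ltW.
  exact: (psdmx_complex_hessian oU smu oO OU pshu Kz).
have c2 v w z : U z -> {for z, continuous ('D_v ('D_w u))}.
  by move=> Uz; have [] := smu [:: v; w] z Uz.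
(* The coefficients of dd^c u are replaced on K by explicit second derivatives, whose continuity on
   U is known. *)
have bm (h g : 'rV[R]_(n + n) -> R) : (forall z, U z -> {for z, continuous g}) ->
    (forall z, K z -> h z = g z) -> bounded_measurable K h.
  move=> cg hg; have [mg [M gM]] := continuous_bounded_measurable oU cK OU cg.
  split; last by exists M => z Kz; rewrite hg// gM.
  by apply: eq_measurable_fun mg => z; rewrite inE => Kz; rewrite hg.
have bRe j k : bounded_measurable K (fun z => complex.Re (ddc kappa u z j k)).
  apply: (bm _ (fun z => kappa * (4^-1 *
    ('D_(real_basis R (lshift n j)) ('D_(real_basis R (lshift n k)) u) z +
     'D_(real_basis R (rshift n j)) ('D_(real_basis R (rshift n k)) u) z)))).
    move=> z Uz; exact: (cvgM (cvg_cst kappa) (cvgM (cvg_cst (4^-1 : R))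
      (cvgD (c2 _ _ _ Uz) (c2 _ _ _ Uz)))).
  move=> z /OU Uz; rewrite mxE (complex_hessianE smu j k Uz) /=.
  by rewrite mul0r subr0.
have bIm j k : bounded_measurable K (fun z => complex.Im (ddc kappa u z j k)).
  apply: (bm _ (fun z => kappa * (4^-1 *
    ('D_(real_basis R (lshift n j)) ('D_(real_basis R (rshift n k)) u) z -
     'D_(real_basis R (rshift n j)) ('D_(real_basis R (lshift n k)) u) z)))).
    move=> z Uz; exact: (cvgM (cvg_cst kappa) (cvgM (cvg_cst (4^-1 : R))
      (cvgB (c2 _ _ _ Uz) (c2 _ _ _ Uz)))).
  move=> z /OU Uz; rewrite mxE (complex_hessianE smu j k Uz) /=.
  by rewrite mul0r addr0.
have [itr le_tr] := le_current_pairing mK posT acT psd_ddc bRe bIm.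
have testu : \int[mu]_(z in boundary Omega) u z - u x =
    complex.Re (current_pairing K T (ddc kappa u)).
  by rewrite -testT//; exists U.
rewrite testu; set tr := fun z => complex.Re (\tr (ddc kappa u z *m Theta z)).
have tr_ge0 z : K z -> 0 <= tr z.
  move=> Kz; have [_ _ + _] := psdmx_mul_det_le_tr (psd_ddc z Kz) (psdTheta z).
  by rewrite lecE => /andP[].
have mtr : measurable_fun K (EFin \o tr) by apply: measurable_int itr.
apply: (@le_trans _ _ (\int[lebesgue_rV R (n + n)]_(z in K) (tr z)%:E)%E); last first.
  rewrite -(fineK (integrable_fin_num mK itr)) lee_fin; exact: le_tr.
(* The boundary of Omega may have positive Lebesgue measure; the trace is nonnegative there because
   dd^c u is positive up to the closure. *)
apply: (@le_trans _ _ (\int[lebesgue_rV R (n + n)]_(z in Omega) (tr z)%:E)%E); last first.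
  by apply: ge0_subset_integral => // z Kz; rewrite lee_fin tr_ge0.
have mF : measurable_fun Omega
    (fun z => f z `^ n%:R^-1 * complex.Re (\det (Theta z)) `^ n%:R^-1).
  have mf : measurable_fun Omega f.
    apply: continuous_measurable_rV => // z Oz.
    have := continuous_subspaceW OK cf; rewrite continuous_open_subspace//.
    by apply; rewrite inE.
  have [iRe iIm _] := acT.
  have mdet : cmeasurable Omega (fun z => \det (Theta z)).
    apply: cmeasurable_det => j k; split; apply: measurable_funTS; apply/measurable_EFinP.
      exact: (measurable_int _ (iRe j k)).
    exact: (measurable_int _ (iIm j k)).
  have mpow := @measurable_powR R n%:R^-1.
  exact: measurable_funM (measurableT_comp mpow mf) (measurableT_comp mpow mdet.1).
rewrite -ge0_integralZl_EFin//.
- apply: ge0_le_integral => //.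
  + by move=> z Oz; rewrite -EFinM lee_fin !mulr_ge0 ?powR_ge0// invr_ge0.
  + exact/measurable_funeM/measurable_EFinP.
  + exact: measurable_funS mtr.
  + move=> z Oz; rewrite -EFinM lee_fin.
    exact: (form11_top_det_le_tr n_gt0 (psd_ddc z (OK _ Oz)) (psdTheta z)
      (f_ge0 z (OK _ Oz)) (MA z Oz)).
- move=> z Oz; rewrite lee_fin mulr_ge0 ?powR_ge0//.
- exact/measurable_EFinP.
Qed.
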